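(* Let $\mathcal M=\langle M,\in,\mathcal C\rangle\models\mathrm{GB}$ be a transitive model and let $\mathcal S=\langle\mathbb P,\mathcal G,\mathcal F\rangle$ be a class symmetric system in $\mathcal M$. If $\mathcal S$ admits forcing relations (in $\mathcal M$), then for any given first-order formula $\varphi$ with fixed class $\mathcal S$-name parameters $\vec\Gamma$, whenever $G\subseteq P$ is $\mathcal S$-generic and $\vec{\dot x}\in\mathrm{HS}$, $$\mathcal M[G]_{\mathcal S}\models\varphi(\vec{\dot x}^G,\vec\Gamma^G)\iff(\exists p\in G)\ p\Vdash_{\mathcal S}\varphi(\vec{\dot x},\vec\Gamma).$$
   Context: $\mathrm{GB}$ is two-sorted Gödel--Bernays set theory without choice (lowercase variables for sets, uppercase for classes): Extensionality, Regularity, Pairing, Union, Infinity, Powerset for sets; Extensionality for classes; every set is a class; Separation ($a\cap A$ is a set for every set $a$ and class $A$); Collection (for every set $a$ and class relation $R$ with $\forall x\in a\,\exists y\,\langle x,y\rangle\in R$ there is a set $b$ with $\forall x\in a\,\exists y\in b\,\langle x,y\rangle\in R$); and class existence axioms equivalent to comprehension for first-order formulas. First-order formulas have no class quantifiers but may contain atomic formulas $x\in X$ and $X=Y$ with class variables. Setting. We work in an ambient universe $V$ of set theory. $\mathcal M=\langle M,\in,\mathcal C\rangle$ is a transitive model of $\mathrm{GB}$ in $V$: $M$ (its sets) and $\mathcal C$ (its classes) are both transitive and its elementhood relation is the true $\in$. The notions ''class symmetric system'', ''$\mathrm{HS}$'', ''$\mathcal S$-name'', forcing relations are interpreted in $\mathcal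 M$. Class symmetric system. A triple $\mathcal S=\langle\mathbb P,\mathcal G,\mathcal F\rangle$ where: $\mathbb P=\langle P,\le\rangle$ is a preorder with $P,\le$ classes and weakest element $\mathsf 1$; $\mathcal G$ is a group of automorphisms of $\mathbb P$ parametrized by sets, i.e. there is a class $C_{\mathcal G}\subseteq V\times P^2$ such that for each $a\in\operatorname{dom}C_{\mathcal G}$, $\pi_a=\{\langle p,q\rangle\mid\langle a,p,q\rangle\in C_{\mathcal G}\}$ is an automorphism of $\mathbb P$ and $\mathcal G=\{\pi_a\mid a\in\operatorname{dom}C_{\mathcal G}\}$ is a group; $\mathcal F$ is a normal filter of subgroups of $\mathcal G$ with a base parametrized by sets, i.e. there is a class $C_{\mathcal F}\subseteq V\times\operatorname{dom}C_{\mathcal G}$ such that for every $a\in\operatorname{dom}C_{\mathcal F}$, $H_a=\{\pi_d\mid\langle a,d\rangle\in C_{\mathcal F}\}$ is a subgroup of $\mathcal G$; some $H_b$ equals $\mathcal G$; for all $a,b$ in $\operatorname{dom}C_{\mathcal F}$ there is $c$ in it with $H_c\subseteq H_a\cap H_b$; and for all $a\in\operatorname{dom}C_{\mathcal F}$, $d\in\operatorname{dom}C_{\mathcal G}$ there is $c\in\operatorname{dom}C_{\mathcal F}$ with $H_c\subseteq\pi_dH_a\pi_d^{-1}$. $\mathcal F$ consists of all subgroups $H=\{\pi_b\mid b\in C\}$ of $\mathcal G$, $C$ a class, with $H_a\subseteq H$ for some $a\in\operatorname{dom}C_{\mathcal F}$. (Inside $\mathcal M$, $V$ here means $M$.) Names.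 A $\mathbb P$-name is a set or class of pairs $\langle\dot y,p\rangle$ with (recursively) $\dot y$ a set-size $\mathbb P$-name and $p\in P$. For $\pi\in\mathcal G$, $\pi(\dot x)=\{\langle\pi(\dot y),\pi(p)\rangle\mid\langle\dot y,p\rangle\in\dot x\}$. $\dot x$ is symmetric if $\operatorname{sym}(\dot x)=\{\pi\in\mathcal G\mid\pi(\dot x)=\dot x\}\in\mathcal F$, and hereditarily symmetric (an $\mathcal S$-name) if it is symmetric and recursively every $\dot y\in\operatorname{dom}(\dot x)$ is hereditarily symmetric. $\mathrm{HS}$ is the class of all set-size $\mathcal S$-names. Forcing relation for atomic formulas. A class relation $\Vdash_0$ such that for all $p\in P$, $\dot x,\dot y\in\mathrm{HS}$: (1) $p\Vdash_0\dot x\in\dot y$ iff $\{q\in P\mid\exists\langle\dot z,r\rangle\in\dot y\,(q\le r\wedge q\Vdash_0\dot x=\dot z)\}$ is dense below $p$; (2) $p\Vdash_0\dot x\subseteq\dot y$ iff for every $\langle\dot z,r\rangle\in\dot x$ and every $s\le p,r$ there is $q\le s$ with $q\Vdash_0\dot z\in\dot y$; (3) $p\Vdash_0\dot x=\dot y$ iff $p\Vdash_0\dot x\subseteq\dot y$ and $p\Vdash_0\dot y\subseteq\dot x$. Such a relation is unique if it exists. $\mathcal S$ admits forcing relations if such a class exists (equivalently, if it admits a forcing relation for any finite list of first-order formulas with fixed class $\mathcal S$-name parameters). Forcing first-order formulas. Given $\Vdash_0$, define recursively on $\varphi$ (set variables assigned elements of $\mathrm{HS}$, class variables assigned class $\mathcal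 S$-names): $p\Vdash_{\mathcal S}\dot x\in\dot y$ and $p\Vdash_{\mathcal S}\dot x=\dot y$ as for $\Vdash_0$; $p\Vdash_{\mathcal S}\dot x\in\dot X$ iff $\forall q\le p\,\exists r\le q\,\exists\langle\dot z,s\rangle\in\dot X\,(r\le s\wedge r\Vdash_0\dot x=\dot z)$; $p\Vdash_{\mathcal S}\dot X=\dot Y$ iff $p\Vdash_{\mathcal S}\forall x(x\in\dot X\leftrightarrow x\in\dot Y)$; $p\Vdash_{\mathcal S}\varphi\wedge\psi$ iff both are forced by $p$; $p\Vdash_{\mathcal S}\neg\varphi$ iff no $q\le p$ forces $\varphi$; $p\Vdash_{\mathcal S}\exists z\,\varphi$ iff $\forall q\le p\,\exists r\le q\,\exists\dot z\in\mathrm{HS}\ r\Vdash_{\mathcal S}\varphi(\dot z)$. ($\forall,\to,\leftrightarrow$ are abbreviations via $\neg,\wedge,\exists$.) For a fixed $\varphi$ and fixed class parameters this is a class of $\mathcal M$. Generics. A set or class $A\subseteq P$ is symmetric if $\{\pi\in\mathcal G\mid\pi[A]=A\}\in\mathcal F$, and symmetrically dense if it is symmetric and dense in $\mathbb P$. A filter $G\subseteq P$ is $\mathcal S$-generic if it meets every symmetrically dense subclass of $\mathbb P$ in $\mathcal M$. For a $\mathbb P$-name, $\dot x^G=\{\dot y^G\mid\exists p\in G\ \langle\dot y,p\rangle\in\dot x\}$. $\mathcal M[G]_{\mathcal S}=\langle M[G]_{\mathcal S},\in,\mathcal C[G]_{\mathcal S}\rangle$ with $M[G]_{\mathcal S}=\{\dot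 x^G\mid\dot x\in\mathrm{HS}\}$ (sets) and $\mathcal C[G]_{\mathcal S}=\{\dot X^G\mid\dot X\in\mathcal C\text{ is an }\mathcal S\text{-name}\}$ (classes). *)

(* Defs.v *)
From Stdlib Require Export Utf8.
From Stdlib Require Import Classical ClassicalEpsilon FunctionalExtensionality.
From Stdlib Require Import Wellfounded.

Set Implicit Arguments.
Unset Strict Implicit.

(* A universe of ZF sets (choice is not needed).  Separation, replacement and
    foundation range over arbitrary predicates and functions of the metatheory;
    by extensionality the set-forming operations are determined by their
    specifications. *)

Record universe := Universe {
  carrier :> Type;
  mem : carrier → carrier → Prop;
  emptyset : carrier;
  upair : carrier → carrier → carrier;
  union : carrier → carrier;
  power : carrier → carrier;
  sep : (carrier → Prop) → carrier → carrier;
  repl : (carrier → carrier) → carrier → carrier;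
  infset : carrier;
  mem_ext : ∀ a b, (∀ x, mem x a ↔ mem x b) → a = b;
  mem_wf : well_founded mem;
  mem_emptyset : ∀ x, ¬ mem x emptyset;
  mem_upair : ∀ a b x, mem x (upair a b) ↔ x = a ∨ x = b;
  mem_union : ∀ a x, mem x (union a) ↔ ∃ y, mem y a ∧ mem x y;
  mem_power : ∀ a x, mem x (power a) ↔ ∀ y, mem y x → mem y a;
  mem_sep : ∀ Q a x, mem x (sep Q a) ↔ mem x a ∧ Q x;
  mem_repl : ∀ f a z, mem z (repl f a) ↔ ∃ x, mem x a ∧ z = f x;
  infset_zero : mem emptyset infset;
  infset_succ : ∀ x, mem x infset →
    mem (union (upair x (upair x x))) infset
}.

Arguments mem {u}.
Arguments emptyset {u}.
Arguments upair {u}.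
Arguments union {u}.
Arguments power {u}.
Arguments sep {u}.
Arguments repl {u}.
Arguments infset {u}.

Notation "x ∈ a" := (mem x a) (at level 70, no associativity).
Notation "a ⊆ b" := (∀ z, z ∈ a → z ∈ b) (at level 70, no associativity).

Section SetTheory.
Variable V : universe.
Implicit Types a b x y z p q : V.

Definition singleton x : V := upair x x.
Definition succ x : V := union (upair x (singleton x)).
Definition pair x y : V := upair (singleton x) (upair x y).
Definition prod a b : V := union (repl (fun x => repl (pair x) b) a).
Definition dom (r : V) : V := sep (fun x => ∃ y, pair x y ∈ r) (union (union r)).

(* [app r x] is meaningful when exactly one [y] satisfies [pair x y ∈ r]. *)
Definition app (r x : V) : V := epsilon (inhabits emptyset) (fun y => pair x y ∈ r).
Definition image (r a : V) : V := repl (app r) a.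

Definition transitive a : Prop := ∀ x y, x ∈ y → y ∈ a → x ∈ a.

Lemma singletonE x z : z ∈ singleton x ↔ z = x.
Proof. unfold singleton; rewrite mem_upair; tauto. Qed.

Lemma pair_inj x y x' y' : pair x y = pair x' y' → x = x' ∧ y = y'.
Proof.
  intros E.
  assert (Ex : x = x').
  { assert (H : singleton x ∈ pair x' y').
    { rewrite <- E; apply mem_upair; now left. }
    apply mem_upair in H; destruct H as [H|H].
    - apply singletonE; rewrite <- H; now apply singletonE.
    - symmetry; apply singletonE; rewrite H; apply mem_upair; now left. }
  subst x'; split; [reflexivity|].
  assert (H : upair x y ∈ pair x y').
  { rewrite <- E; apply mem_upair; now right. }
  assert (H' : upair x y' ∈ pair x y).
  { rewrite E; apply mem_upair; now right. }
  assert (K : y ∈ upair x y) by (apply mem_upair; now right).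
  assert (K' : y' ∈ upair x y') by (apply mem_upair; now right).
  apply mem_upair in H; apply mem_upair in H'.
  destruct H as [H|H].
  - rewrite H in K; apply singletonE in K; subst y.
    destruct H' as [H'|H']; rewrite H' in K'; try apply mem_upair in K';
      try apply singletonE in K'; intuition congruence.
  - rewrite H in K; apply mem_upair in K; destruct K as [K|K]; [|exact K].
    subst y; destruct H' as [H'|H']; rewrite H' in K'; try apply mem_upair in K';
      try apply singletonE in K'; intuition congruence.
Qed.

(* [name_rec h K x] is [{ h (name_rec h K y) p | ⟨y,p⟩ ∈ x, K p }]. *)

Definition below y x : Prop := ∃ p, pair y p ∈ x.

Lemma below_wf : well_founded below.
Proof.
  apply wf_incl with (R2 := Relation_Operators.clos_trans V mem).
  - intros y x [p Hp].
    apply Relation_Operators.t_trans with (singleton y).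
    { apply Relation_Operators.t_step; now apply singletonE. }
    apply Relation_Operators.t_trans with (pair y p).
    { apply Relation_Operators.t_step; apply mem_upair; now left. }
    now apply Relation_Operators.t_step.
  - apply wf_clos_trans; apply mem_wf.
Qed.

Definition fst z : V := epsilon (inhabits emptyset) (fun y => ∃ p, z = pair y p).
Definition snd z : V := epsilon (inhabits emptyset) (fun p => ∃ y, z = pair y p).

Lemma fst_pair x y : fst (pair x y) = x.
Proof.
  unfold fst.
  destruct (epsilon_spec (inhabits (@emptyset V)) (fun u => ∃ p, pair x y = pair u p))
    as [p Hp]; [now exists x, y|].
  symmetry; exact (proj1 (pair_inj Hp)).
Qed.

Lemma snd_pair x y : snd (pair x y) = y.
Proof.
  unfold snd.
  destruct (epsilon_spec (inhabits (@emptyset V)) (fun p => ∃ u, pair x y = pair u p))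
    as [u Hu]; [now exists y, x|].
  symmetry; exact (proj2 (pair_inj Hu)).
Qed.

Definition name_rec (h : V → V → V) (K : V → Prop) : V → V :=
  Fix below_wf (fun _ => V) (fun x rec =>
    repl (fun z => h (match excluded_middle_informative (below (fst z) x) with
                      | left B => rec (fst z) B
                      | right _ => emptyset
                      end) (snd z))
         (sep (fun z => ∃ y p, z = pair y p ∧ K p) x)).

Lemma mem_name_rec h K x z :
  z ∈ name_rec h K x ↔ ∃ y p, pair y p ∈ x ∧ K p ∧ z = h (name_rec h K y) p.
Proof.
  unfold name_rec at 1; rewrite Fix_eq.
  - fold (name_rec h K); rewrite mem_repl; split.
    + intros (u & Hu & ->); apply mem_sep in Hu as (Hu & y & p & -> & Kp).
      exists y, p; rewrite fst_pair, snd_pair; repeat split; trivial.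
      destruct excluded_middle_informative as [B|B]; [reflexivity|].
      now destruct B; exists p.
    + intros (y & p & Hx & Kp & ->); exists (pair y p); split.
      * apply mem_sep; split; trivial; now exists y, p.
      * rewrite fst_pair, snd_pair.
        destruct excluded_middle_informative as [B|B]; [reflexivity|].
        now destruct B; exists p.
  - intros u f g Hfg; f_equal; apply functional_extensionality; intros v.
    now destruct excluded_middle_informative; rewrite ?Hfg.
Qed.

End SetTheory.

(* Set variables are de Bruijn indices, [Ex] binding index 0; class variables
    are named by natural numbers and never quantified. *)

Inductive formula : Type :=
| Mem (i j : nat)
| Eq (i j : nat)
| MemC (i k : nat)
| EqC (k l : nat)
| And (φ ψ : formula)
| Neg (φ : formula)
| Ex (φ : formula).

Definition scons {T : Type} (a : T) (e : nat → T) (i : nat) : T :=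
  match i with 0 => a | S j => e j end.

(* A structure ⟨sets, ∈, classes⟩, with ∈ the membership of the universe. *)
Record structure (V : universe) := Structure { sets : V; classes : V }.

Section Models.
Variable V : universe.

Fixpoint sat (N : structure V) (φ : formula) (e c : nat → V) : Prop :=
  match φ with
  | Mem i j => e i ∈ e j
  | Eq i j => e i = e j
  | MemC i k => e i ∈ c k
  | EqC k l => c k = c l
  | And φ ψ => sat N φ e c ∧ sat N ψ e c
  | Neg φ => ¬ sat N φ e c
  | Ex φ => ∃ a, a ∈ sets N ∧ sat N φ (scons a e) c
  end.

(* Ordered pairs are those of the universe, which agree with those of [N] when
   [N] is transitive. *)
Record GB (N : structure V) : Prop := {
  GB_extensionality : ∀ a b, a ∈ sets N → b ∈ sets N →
    (∀ x, x ∈ sets N → (x ∈ a ↔ x ∈ b)) → a = b;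
  GB_regularity : ∀ a, a ∈ sets N → (∃ x, x ∈ sets N ∧ x ∈ a) →
    ∃ x, x ∈ sets N ∧ x ∈ a ∧ ¬ ∃ y, y ∈ sets N ∧ y ∈ x ∧ y ∈ a;
  GB_pairing : ∀ a b, a ∈ sets N → b ∈ sets N →
    ∃ d, d ∈ sets N ∧ ∀ x, x ∈ sets N → (x ∈ d ↔ x = a ∨ x = b);
  GB_union : ∀ a, a ∈ sets N →
    ∃ d, d ∈ sets N ∧
      ∀ x, x ∈ sets N → (x ∈ d ↔ ∃ y, y ∈ sets N ∧ y ∈ a ∧ x ∈ y);
  GB_infinity : ∃ d, d ∈ sets N ∧
    (∃ o, o ∈ sets N ∧ (∀ x, x ∈ sets N → ¬ x ∈ o) ∧ o ∈ d) ∧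
    (∀ x, x ∈ sets N → x ∈ d → ∃ s, s ∈ sets N ∧ s ∈ d ∧
       ∀ y, y ∈ sets N → (y ∈ s ↔ y ∈ x ∨ y = x));
  GB_powerset : ∀ a, a ∈ sets N →
    ∃ d, d ∈ sets N ∧
      ∀ x, x ∈ sets N → (x ∈ d ↔ ∀ y, y ∈ sets N → y ∈ x → y ∈ a);
  GB_class_extensionality : ∀ A B, A ∈ classes N → B ∈ classes N →
    (∀ x, x ∈ sets N → (x ∈ A ↔ x ∈ B)) → A = B;
  GB_sets_are_classes : sets N ⊆ classes N;
  GB_separation : ∀ a A, a ∈ sets N → A ∈ classes N →
    ∃ d, d ∈ sets N ∧ ∀ x, x ∈ sets N → (x ∈ d ↔ x ∈ a ∧ x ∈ A);
  GB_collection : ∀ a R, a ∈ sets N → R ∈ classes N →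
    (∀ x, x ∈ sets N → x ∈ a → ∃ y, y ∈ sets N ∧ pair x y ∈ R) →
    ∃ b, b ∈ sets N ∧
      ∀ x, x ∈ sets N → x ∈ a → ∃ y, y ∈ sets N ∧ y ∈ b ∧ pair x y ∈ R;
  GB_class_existence : ∀ φ e c,
    (∀ i, e i ∈ sets N) → (∀ k, c k ∈ classes N) →
    ∃ A, A ∈ classes N ∧ ∀ x, x ∈ sets N → (x ∈ A ↔ sat N φ (scons x e) c)
}.

(* The last clause expresses that the elements of classes are sets; it does not
   follow from the transitivity of [classes N]. *)
Record transitive_GB_model (N : structure V) : Prop := {
  model_GB : GB N;
  model_sets_transitive : transitive (sets N);
  model_classes_transitive : transitive (classes N);
  model_classes_of_sets : ∀ A, A ∈ classes N → A ⊆ sets N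
}.


Record system := System { conds : V; ord : V; weakest : V; C_G : V; C_F : V }.

(* [M] is the model in which the system is interpreted. *)
Variables (M : structure V) (S : system).

Definition leq (p q : V) : Prop := pair p q ∈ ord S.

Record is_preorder : Prop := {
  preorder_field : ord S ⊆ prod (conds S) (conds S);
  preorder_refl : ∀ p, p ∈ conds S → leq p p;
  preorder_trans : ∀ p q r, leq p q → leq q r → leq p r;
  preorder_one : weakest S ∈ conds S;
  preorder_weakest : ∀ p, p ∈ conds S → leq p (weakest S)
}.

Record is_automorphism (π : V) : Prop := {
  aut_field : π ⊆ prod (conds S) (conds S);
  aut_function : ∀ p, p ∈ conds S → exists! q, pair p q ∈ π;
  aut_bijective : ∀ q, q ∈ conds S → exists! p, pair p q ∈ π;
  aut_order : ∀ p p' q q', pair p q ∈ π → pair p' q' ∈ π →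
    (leq p p' ↔ leq q q')
}.

Definition aut_id : V :=
  sep (fun z => ∃ p, z = pair p p) (prod (conds S) (conds S)).
Definition aut_inv (π : V) : V :=
  sep (fun z => ∃ p q, z = pair q p ∧ pair p q ∈ π) (prod (conds S) (conds S)).
(* [aut_comp π σ] is π ∘ σ: [σ] acts first. *)
Definition aut_comp (π σ : V) : V :=
  sep (fun z => ∃ p q r, z = pair p r ∧ pair p q ∈ σ ∧ pair q r ∈ π)
      (prod (conds S) (conds S)).

Definition aut (a : V) : V :=
  sep (fun z => pair a z ∈ C_G S) (prod (conds S) (conds S)).
Definition grp : V := repl aut (dom (C_G S)).

Record is_subgroup (H : V) : Prop := {
  subgroup_sub : H ⊆ grp;
  subgroup_id : aut_id ∈ H;
  subgroup_comp : ∀ π σ, π ∈ H → σ ∈ H → aut_comp π σ ∈ H;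
  subgroup_inv : ∀ π, π ∈ H → aut_inv π ∈ H
}.

Definition base (a : V) : V :=
  repl aut (sep (fun d => pair a d ∈ C_F S) (dom (C_G S))).

Definition conjugate (π H : V) : V :=
  repl (fun σ => aut_comp (aut_comp π σ) (aut_inv π)) H.

Record is_symmetric_system : Prop := {
  sys_classes : conds S ∈ classes M ∧ ord S ∈ classes M ∧
    C_G S ∈ classes M ∧ C_F S ∈ classes M;
  sys_preorder : is_preorder;
  sys_CG : C_G S ⊆ prod (sets M) (prod (conds S) (conds S));
  sys_automorphism : ∀ a, a ∈ dom (C_G S) → is_automorphism (aut a);
  sys_group : is_subgroup grp;
  sys_CF : C_F S ⊆ prod (sets M) (dom (C_G S));
  sys_base_subgroup : ∀ a, a ∈ dom (C_F S) → is_subgroup (base a);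
  sys_base_top : ∃ b, b ∈ dom (C_F S) ∧ base b = grp;
  sys_base_meet : ∀ a b, a ∈ dom (C_F S) → b ∈ dom (C_F S) →
    ∃ c, c ∈ dom (C_F S) ∧ base c ⊆ base a ∧ base c ⊆ base b;
  sys_base_normal : ∀ a d, a ∈ dom (C_F S) → d ∈ dom (C_G S) →
    ∃ c, c ∈ dom (C_F S) ∧ base c ⊆ conjugate (aut d) (base a)
}.

Definition in_filter (H : V) : Prop :=
  is_subgroup H ∧
  (∃ C, C ∈ classes M ∧ C ⊆ dom (C_G S) ∧ H = repl aut C) ∧
  ∃ a, a ∈ dom (C_F S) ∧ base a ⊆ H.

(* Recursions along the relation "⟨y,p⟩ ∈ x" are carried out in the universe;
    by transitivity of [M] they agree with the recursions inside [M]. *)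

Inductive is_name : V → Prop :=
| is_name_intro x :
    (∀ z, z ∈ x → ∃ y p, p ∈ conds S ∧ z = pair y p) →
    (∀ y p, pair y p ∈ x → y ∈ sets M ∧ is_name y) →
    is_name x.

(* π(x) = { ⟨π(y), π(p)⟩ | ⟨y,p⟩ ∈ x } *)
Definition act (π : V) : V → V :=
  name_rec (fun y p => pair y (app π p)) (fun _ => True).

Definition sym (x : V) : V := sep (fun π => act π x = x) grp.

Inductive hereditarily_symmetric : V → Prop :=
| hereditarily_symmetric_intro x :
    is_name x → in_filter (sym x) →
    (∀ y p, pair y p ∈ x → hereditarily_symmetric y) →
    hereditarily_symmetric x.

Definition HS : V := sep hereditarily_symmetric (sets M).
Definition class_name (X : V) : Prop :=
  X ∈ classes M ∧ hereditarily_symmetric X.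


(* The atomic forcing relation [F] is a single class of M; the three relations
   "p ⊩₀ x ∈ y", "p ⊩₀ x ⊆ y" and "p ⊩₀ x = y" are its slices at 0, 1, 2. *)
Definition f0_mem (F p x y : V) : Prop :=
  pair emptyset (pair p (pair x y)) ∈ F.
Definition f0_sub (F p x y : V) : Prop :=
  pair (succ emptyset) (pair p (pair x y)) ∈ F.
Definition f0_eq (F p x y : V) : Prop :=
  pair (succ (succ emptyset)) (pair p (pair x y)) ∈ F.

Definition dense_below (D : V → Prop) (p : V) : Prop :=
  ∀ q, leq q p → ∃ r, leq r q ∧ D r.

Record is_atomic_forcing (F : V) : Prop := {
  f0_class : F ∈ classes M;
  f0_memE : ∀ p x y, p ∈ conds S → x ∈ HS → y ∈ HS →
    (f0_mem F p x y ↔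
     dense_below
       (fun q => ∃ z r, pair z r ∈ y ∧ leq q r ∧ f0_eq F q x z) p);
  f0_subE : ∀ p x y, p ∈ conds S → x ∈ HS → y ∈ HS →
    (f0_sub F p x y ↔
     ∀ z r, pair z r ∈ x → ∀ s, leq s p → leq s r →
       ∃ q, leq q s ∧ f0_mem F q z y);
  f0_eqE : ∀ p x y, p ∈ conds S → x ∈ HS → y ∈ HS →
    (f0_eq F p x y ↔ f0_sub F p x y ∧ f0_sub F p y x)
}.

Definition admits_forcing_relations : Prop := ∃ F, is_atomic_forcing F.

(* Forcing clauses of the connectives act on properties of conditions, so that the
   clause for class equality can use the formula it abbreviates without being
   a recursive call on a larger formula. *)
Definition f_and (A B : V → Prop) (p : V) : Prop := A p ∧ B p.
Definition f_neg (A : V → Prop) (p : V) : Prop := ¬ ∃ q, leq q p ∧ A q.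
Definition f_ex (A : V → V → Prop) (p : V) : Prop :=
  ∀ q, leq q p → ∃ r, leq r q ∧ ∃ z, z ∈ HS ∧ A z r.
Definition f_all (A : V → V → Prop) : V → Prop :=
  f_neg (f_ex (fun z => f_neg (A z))).
Definition f_imp (A B : V → Prop) : V → Prop := f_neg (f_and A (f_neg B)).
Definition f_iff (A B : V → Prop) : V → Prop := f_and (f_imp A B) (f_imp B A).

Definition f_memC (F x X p : V) : Prop :=
  ∀ q, leq q p → ∃ r, leq r q ∧
    ∃ z s, pair z s ∈ X ∧ leq r s ∧ f0_eq F r x z.

Fixpoint forces (F : V) (φ : formula) (x Γ : nat → V) : V → Prop :=
  match φ with
  | Mem i j => fun p => f0_mem F p (x i) (x j)
  | Eq i j => fun p => f0_eq F p (x i) (x j)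
  | MemC i k => f_memC F (x i) (Γ k)
  | EqC k l => f_all (fun z => f_iff (f_memC F z (Γ k)) (f_memC F z (Γ l)))
  | And φ ψ => f_and (forces F φ x Γ) (forces F ψ x Γ)
  | Neg φ => f_neg (forces F φ x Γ)
  | Ex φ => f_ex (fun z => forces F φ (scons z x) Γ)
  end.


Definition symmetric_subset (A : V) : Prop :=
  in_filter (sep (fun π => image π A = A) grp).

Definition dense (D : V) : Prop :=
  ∀ p, p ∈ conds S → ∃ q, q ∈ D ∧ leq q p.

Record is_filter (G : V) : Prop := {
  filter_sub : G ⊆ conds S;
  filter_nonempty : ∃ p, p ∈ G;
  filter_up : ∀ p q, p ∈ G → leq p q → q ∈ G;
  filter_dir : ∀ p q, p ∈ G → q ∈ G → ∃ r, r ∈ G ∧ leq r p ∧ leq r q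
}.

Definition is_generic (G : V) : Prop :=
  is_filter G ∧
  ∀ D, D ∈ classes M → D ⊆ conds S → symmetric_subset D → dense D →
    ∃ p, p ∈ D ∧ p ∈ G.

(* x^G = { y^G | ⟨y,p⟩ ∈ x, p ∈ G } *)
Definition val (G : V) : V → V := name_rec (fun y _ => y) (fun p => p ∈ G).

Definition extension (G : V) : structure V :=
  Structure (repl (val G) HS) (repl (val G) (sep class_name (classes M))).

End Models.

(* Main.v *)
Require Import Defs.
From Stdlib Require Import Classical ClassicalEpsilon FunctionalExtensionality PeanoNat Lia.

Set Implicit Arguments.
Unset Strict Implicit.

(** The truth lemma for symmetric extensions is proved by induction on formulas,
    the set-name parameters varying.  As for ordinary forcing, every nontrivial
    step needs the generic filter to meet a class of conditions that decides
    something.  Here it meets only the symmetrically dense classes of the model,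
    so each such class E has to be shown to be
    - a class of the model: its defining condition is first-order with class
      parameters;
    - symmetric: it is invariant under all automorphisms in some base group of
      the filter of subgroups.
    Both requirements are collected in [symmetric_class].  If such an E is dense
    below some p in G, then E together with the conditions having no extension
    in E is symmetrically dense, and a common extension with p shows that G meets
    E itself ([generic_meets_below]).

    First-orderness.  [definable] is the class of predicates of assignments that
    are given by formulas over the model, and the tactic [definability] derives
    it from the shape of a predicate.  The substantial case is that HS is a
    class of the model ([HS_class]): the quantifier of a forced existential
    ranges over HS.  HS is defined by recursion in the universe, and so is the
    action of an automorphism on names.  Both recursions are replaced by
    first-order statements that a set of the model witnesses: a [coherent] set of
    pairs for the action, a [closed_symmetric] set for HS.  The witnesses are
    found by induction on names, with Collection gluing those of the
    elements of a name.

    Symmetry.  An automorphism in the group preserves HS ([HS_act], by normality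
    of the filter) and carries p forcing a formula to its image forcing
    the formula of the moved names ([f0_eq_act], [forces_act]).  A formula has
    finitely many parameters and each is fixed by a base group; a base group
    contained in all of these fixes all parameters at once, which makes
    every class used below symmetric.

    Truth.  For atomic formulas, the value of a name x equals that of y when both
    inclusions hold, an inclusion reduces to membership of the elements of x in
    y, and membership of z in y reduces to equality of z with elements of y.
    So equality of x and y reduces to equality of their elements, taken in
    either order, and one induction on x proves it for all y
    ([f0_eq_truth]).  Negation uses that the conditions deciding a formula are
    dense, the existential quantifier that the conditions forcing an instance
    are dense below a condition forcing it; equality of classes is the formula
    it abbreviates. *)

(** * Predicates definable over the model *)

Fixpoint rename (ρ f : nat → nat) (φ : formula) : formula :=
  match φ with
  | Mem i j => Mem (ρ i) (ρ j)
  | Eq i j => Eq (ρ i) (ρ j)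
  | MemC i k => MemC (ρ i) (f k)
  | EqC k l => EqC (f k) (f l)
  | And φ ψ => And (rename ρ f φ) (rename ρ f ψ)
  | Neg φ => Neg (rename ρ f φ)
  | Ex φ => Ex (rename (scons 0 (fun i => S (ρ i))) f φ)
  end.

Lemma scons_comp {T U : Type} (g : T → U) a e :
  (fun i => g (scons a e i)) = scons (g a) (fun i => g (e i)).
Proof. apply functional_extensionality; now intros [|i]. Qed.

Lemma sat_rename (V : universe) (M : structure V) φ : ∀ ρ f e c,
  sat M (rename ρ f φ) e c ↔ sat M φ (fun i => e (ρ i)) (fun k => c (f k)).
Proof.
  induction φ as [i j|i j|i k|k l|φ IH ψ IH'|φ IH|φ IH]; intros; cbn; try tauto.
  - now rewrite IH, IH'.
  - now rewrite IH.
  - split; intros (a & Ha & H); exists a; split; trivial.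
    + apply IH in H; now rewrite scons_comp in H.
    + apply IH; now rewrite scons_comp.
Qed.

Lemma domE (V : universe) (r x : V) : x ∈ dom r ↔ ∃ y, pair x y ∈ r.
Proof.
  unfold dom; rewrite mem_sep; split; [tauto|].
  intros [y H]; split; [|now exists y].
  apply mem_union; exists (singleton x); split; [|now apply singletonE].
  apply mem_union; exists (pair x y); split; trivial.
  apply mem_upair; now left.
Qed.

Lemma prodE (V : universe) (a b z : V) :
  z ∈ prod a b ↔ ∃ x y, x ∈ a ∧ y ∈ b ∧ z = pair x y.
Proof.
  unfold prod; rewrite mem_union; split.
  - intros (u & Hu & Hz); apply mem_repl in Hu as (x & Hx & ->).
    apply mem_repl in Hz as (y & Hy & ->); eauto.
  - intros (x & y & Hx & Hy & ->); exists (repl (pair x) b).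
    rewrite !mem_repl; split; [now exists x|now exists y].
Qed.

Lemma pair_in_prod (V : universe) (a b x y : V) :
  pair x y ∈ prod a b ↔ x ∈ a ∧ y ∈ b.
Proof.
  rewrite prodE; split; [|firstorder].
  intros (x' & y' & Hx & Hy & E); apply pair_inj in E as [-> ->]; auto.
Qed.

Section Forcing.
Variables (V : universe) (M : structure V).
Hypothesis hM : transitive_GB_model M.

Definition assignment (e : nat → V) : Prop := ∀ i, e i ∈ sets M.

Lemma scons_assignment a e : a ∈ sets M → assignment e → assignment (scons a e).
Proof. intros Ha He [|i]; cbn; auto. Qed.

(** Definability is a property of predicates of assignments rather than of
    formulas, so that predicates can be written with the logical connectives
    and de Bruijn indices occur only as applications of the assignment.  All
    class parameters are existentially quantified here, which makes a class
    defined by comprehension available as a parameter of later predicates. *)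
Definition definable (Q : (nat → V) → Prop) : Prop :=
  ∃ φ c, (∀ k, c k ∈ classes M) ∧ ∀ e, assignment e → (Q e ↔ sat M φ e c).

Lemma definable_ext (Q R : (nat → V) → Prop) :
  definable Q → (∀ e, assignment e → (R e ↔ Q e)) → definable R.
Proof.
  intros (φ & c & Hc & H) E; exists φ, c; split; trivial.
  intros e He; now rewrite E, H.
Qed.

Lemma definable_rename Q (ρ : nat → nat) :
  definable Q → definable (fun e => Q (fun i => e (ρ i))).
Proof.
  intros (φ & c & Hc & H); exists (rename ρ (fun k => k) φ), c; split; trivial.
  intros e He; rewrite sat_rename; apply H; intros i; apply He.
Qed.

Lemma definable_and Q R :
  definable Q → definable R → definable (fun e => Q e ∧ R e).
Proof.
  intros (φ & c & Hc & H) (ψ & d & Hd & K).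
  (* The class parameters of the conjuncts are interleaved, those of Q at the
     even places. *)
  exists (And (rename (fun i => i) (fun k => 2 * k) φ)
              (rename (fun i => i) (fun k => S (2 * k)) ψ)),
    (fun k => if Nat.even k then c (Nat.div2 k) else d (Nat.div2 k)); split.
  { intros k; destruct (Nat.even k); auto. }
  intros e He; cbn [sat]; rewrite !sat_rename, H, K by trivial.
  replace (fun k => if Nat.even (2 * k) then c (Nat.div2 (2 * k))
                    else d (Nat.div2 (2 * k))) with c.
  2: { apply functional_extensionality; intros k.
       now rewrite Nat.even_even, Nat.div2_double. }
  replace (fun k => if Nat.even (S (2 * k)) then c (Nat.div2 (S (2 * k)))
                    else d (Nat.div2 (S (2 * k)))) with d.
  2: { apply functional_extensionality; intros k.
       now rewrite Nat.div2_succ_double, Nat.even_succ, Nat.odd_even. }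
  reflexivity.
Qed.

Lemma definable_not Q : definable Q → definable (fun e => ¬ Q e).
Proof.
  intros (φ & c & Hc & H); exists (Neg φ), c; split; trivial.
  intros e He; cbn; now rewrite H.
Qed.

Lemma definable_or Q R :
  definable Q → definable R → definable (fun e => Q e ∨ R e).
Proof.
  intros H K; eapply definable_ext.
  { exact (definable_not (definable_and (definable_not H) (definable_not K))). }
  intros e _; cbn; tauto.
Qed.

Lemma definable_imp Q R :
  definable Q → definable R → definable (fun e => Q e → R e).
Proof.
  intros H K; eapply definable_ext.
  { exact (definable_not (definable_and H (definable_not K))). }
  intros e _; cbn; tauto.
Qed.

Lemma definable_iff Q R :
  definable Q → definable R → definable (fun e => Q e ↔ R e).
Proof.
  intros H K; exact (definable_and (definable_imp H K) (definable_imp K H)).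
Qed.

(** The quantifier ranges over the whole universe; the second premise makes it
    equivalent to the one over the sets of the model. *)
Lemma definable_ex (Q : V → (nat → V) → Prop) :
  definable (fun e => Q (e 0) (fun i => e (S i))) →
  (∀ e, assignment e → ∀ a, Q a e → a ∈ sets M) →
  definable (fun e => ∃ a, Q a e).
Proof.
  intros (φ & c & Hc & H) B; exists (Ex φ), c; split; trivial.
  intros e He; cbn; split.
  - intros (a & Ha); assert (a ∈ sets M) by eauto.
    exists a; split; trivial; apply H; [now apply scons_assignment|exact Ha].
  - intros (a & Ha & K); exists a; apply H in K; [exact K|].
    now apply scons_assignment.
Qed.

Lemma definable_all (Q : V → (nat → V) → Prop) :
  definable (fun e => Q (e 0) (fun i => e (S i))) →
  (∀ e, assignment e → ∀ a, ¬ Q a e → a ∈ sets M) →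
  definable (fun e => ∀ a, Q a e).
Proof.
  intros H B; eapply definable_ext.
  { exact (definable_not (definable_ex (definable_not H) B)). }
  intros e _; split; [intros K [a Ha]; exact (Ha (K a))|].
  intros K a; apply NNPP; intros Ha; apply K; now exists a.
Qed.

(** Terms denoting sets of the model, with definable graph.  They may be
    substituted for variables because a term can be named by an
    existential quantifier over the model. *)
Definition definable_fun (t : (nat → V) → V) : Prop :=
  definable (fun e => e 0 = t (fun i => e (S i))) ∧
  ∀ e, assignment e → t e ∈ sets M.

Lemma definable_fun_rename t (ρ : nat → nat) :
  definable_fun t → definable_fun (fun e => t (fun i => e (ρ i))).
Proof.
  intros [H K]; split.
  - exact (definable_rename (scons 0 (fun i => S (ρ i))) H).
  - intros e He; apply K; intros i; apply He.
Qed.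

(** The instance at t says that some a equal to t satisfies Q. *)
Lemma definable_subst (Q : V → (nat → V) → Prop) t :
  definable (fun e => Q (e 0) (fun i => e (S i))) → definable_fun t →
  definable (fun e => Q (t e) e).
Proof.
  intros H [T K]; apply definable_ext with (fun e => ∃ a, a = t e ∧ Q a e).
  - apply (definable_ex (definable_and T H)).
    intros e He a [-> _]; auto.
  - intros e _; split; [eauto|now intros (a & -> & h)].
Qed.

Definition definable1 (Q : V → Prop) : Prop := definable (fun e => Q (e 0)).
Definition definable2 (Q : V → V → Prop) : Prop :=
  definable (fun e => Q (e 0) (e 1)).
Definition definable3 (Q : V → V → V → Prop) : Prop :=
  definable (fun e => Q (e 0) (e 1) (e 2)).

Lemma definable1_app Q t :
  definable1 Q → definable_fun t → definable (fun e => Q (t e)).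
Proof.
  intros H T; exact (definable_subst (Q := fun a _ => Q a) H T).
Qed.

Lemma definable2_app Q t s :
  definable2 Q → definable_fun t → definable_fun s →
  definable (fun e => Q (t e) (s e)).
Proof.
  intros H T T'; apply (definable_subst (Q := fun a e => Q a (s e))); trivial.
  apply (definable_subst (Q := fun b e => Q (e 0) b)).
  - exact (definable_rename (scons 1 (scons 0 (fun i => i))) H).
  - exact (definable_fun_rename S T').
Qed.

Lemma definable3_app Q t s u :
  definable3 Q → definable_fun t → definable_fun s → definable_fun u →
  definable (fun e => Q (t e) (s e) (u e)).
Proof.
  intros H T T' T''; apply (definable_subst (Q := fun a e => Q a (s e) (u e))); trivial.
  apply (definable_subst (Q := fun b e => Q (e 0) b (u (fun i => e (S i))))).
  2: exact (definable_fun_rename S T').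
  apply (definable_subst (Q := fun c e => Q (e 1) (e 0) c)).
  - exact (definable_rename (scons 2 (scons 1 (scons 0 (fun i => i)))) H).
  - exact (definable_fun_rename (fun i => S (S i)) T'').
Qed.

Lemma sets_are_classes a : a ∈ sets M → a ∈ classes M.
Proof. apply (GB_sets_are_classes (model_GB hM)). Qed.

Lemma in_set_in_M x a : x ∈ a → a ∈ sets M → x ∈ sets M.
Proof. apply (model_sets_transitive hM). Qed.

Lemma in_class_in_M x A : x ∈ A → A ∈ classes M → x ∈ sets M.
Proof. intros Hx HA; exact (model_classes_of_sets hM HA Hx). Qed.

(** Equality is needed in the universe, whose set-forming operations are
    compared with those that the axioms provide inside the model. *)
Lemma class_ext A B : A ∈ classes M →
  (∀ x, x ∈ B → x ∈ sets M) → (∀ x, x ∈ sets M → (x ∈ A ↔ x ∈ B)) → A = B.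
Proof.
  intros HA HB H; apply mem_ext; intros x; split; intros Hx.
  - apply H; trivial; exact (in_class_in_M Hx HA).
  - apply H; auto.
Qed.

Lemma empty_in_M : emptyset ∈ sets M.
Proof.
  destruct (GB_infinity (model_GB hM)) as (d & _ & (o & Ho & H & _) & _).
  replace emptyset with o; trivial.
  apply class_ext; [now apply sets_are_classes| |].
  - intros x Hx; now apply mem_emptyset in Hx.
  - intros x Hx; split; intros Hx'; [now apply H in Hx'|now apply mem_emptyset in Hx'].
Qed.

Lemma upair_in_M a b : a ∈ sets M → b ∈ sets M → upair a b ∈ sets M.
Proof.
  intros Ha Hb; destruct (GB_pairing (model_GB hM) Ha Hb) as (d & Hd & H).
  replace (upair a b) with d; trivial.
  apply class_ext; [now apply sets_are_classes| |].
  - intros x Hx; apply mem_upair in Hx as [-> | ->]; trivial.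
  - intros x Hx; rewrite H, mem_upair by trivial; tauto.
Qed.

Lemma pair_in_M a b : a ∈ sets M → b ∈ sets M → pair a b ∈ sets M.
Proof. intros; unfold pair, singleton; auto using upair_in_M. Qed.

Lemma union_in_M a : a ∈ sets M → union a ∈ sets M.
Proof.
  intros Ha; destruct (GB_union (model_GB hM) Ha) as (d & Hd & H).
  replace (union a) with d; trivial.
  apply class_ext; [now apply sets_are_classes| |].
  - intros x Hx; apply mem_union in Hx as (y & Hy & Hx).
    eapply in_set_in_M; [exact Hx|]; eapply in_set_in_M; eauto.
  - intros x Hx; rewrite H, mem_union by trivial.
    split; [intros (y & _ & Hy & Hxy); now exists y|intros (y & Hy & Hxy)].
    exists y; repeat split; trivial; eapply in_set_in_M; eauto.
Qed.

Lemma succ_in_M a : a ∈ sets M → succ a ∈ sets M.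
Proof. intros; unfold succ, singleton; auto using union_in_M, upair_in_M. Qed.

Lemma pair_in_M_inv a b : pair a b ∈ sets M → a ∈ sets M ∧ b ∈ sets M.
Proof.
  intros H; assert (K : upair a b ∈ sets M).
  { apply in_set_in_M with (pair a b); trivial; apply mem_upair; now right. }
  split; (apply in_set_in_M with (upair a b); [|trivial]); apply mem_upair; auto.
Qed.

Lemma definable_class t A :
  definable_fun t → A ∈ classes M → definable (fun e => t e ∈ A).
Proof.
  intros T HA; apply (definable1_app (Q := fun a => a ∈ A)); trivial.
  exists (MemC 0 0), (fun _ => A); split; trivial; reflexivity.
Qed.

Lemma definable_mem t s :
  definable_fun t → definable_fun s → definable (fun e => t e ∈ s e).
Proof.
  apply (definable2_app (Q := fun a b => a ∈ b)).
  exists (Mem 0 1), (fun _ => emptyset); split; [|reflexivity].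
  intros _; apply sets_are_classes, empty_in_M.
Qed.

Lemma definable_eq t s :
  definable_fun t → definable_fun s → definable (fun e => t e = s e).
Proof.
  apply (definable2_app (Q := fun a b => a = b)).
  exists (Eq 0 1), (fun _ => emptyset); split; [|reflexivity].
  intros _; apply sets_are_classes, empty_in_M.
Qed.

Lemma definable_var i : definable_fun (fun e => e i).
Proof.
  split; [|intros e He; apply He].
  exists (Eq 0 (S i)), (fun _ => emptyset); split; [|reflexivity].
  intros _; apply sets_are_classes, empty_in_M.
Qed.

Lemma definable_const a : a ∈ sets M → definable_fun (fun _ => a).
Proof.
  intros Ha; split; trivial.
  apply definable_ext with (fun e => e 0 ∈ upair a a).
  - apply definable_class; [apply definable_var|].
    apply sets_are_classes; now apply upair_in_M.
  - intros e _; rewrite mem_upair; tauto.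
Qed.

Lemma definable_upair t s :
  definable_fun t → definable_fun s → definable_fun (fun e => upair (t e) (s e)).
Proof.
  intros T T'; split.
  2: { intros e He; apply upair_in_M; [now apply T|now apply T']. }
  apply (definable3_app (Q := fun c a b => c = upair a b)
    (t := fun e => e 0) (s := fun e => t (fun i => e (S i)))
    (u := fun e => s (fun i => e (S i))));
    [|apply definable_var|now apply definable_fun_rename with (ρ := S)..].
  apply definable_ext with (fun e => ∀ z, z ∈ sets M → (z ∈ e 0 ↔ z = e 1 ∨ z = e 2)).
  - apply definable_all.
    + cbv beta; apply definable_ext with (fun e => e 0 ∈ e 1 ↔ e 0 = e 2 ∨ e 0 = e 3).
      * apply definable_iff; [|apply definable_or]; first [apply definable_mem|apply definable_eq];
          apply definable_var.
      * intros e He; split; auto.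
    + intros e He a Ha; apply NNPP; tauto.
  - intros e He; split.
    + intros -> z _; apply mem_upair.
    + intros H; apply class_ext; [apply sets_are_classes, He| |].
      * intros x Hx; apply mem_upair in Hx as [-> | ->]; apply He.
      * intros x Hx; rewrite mem_upair; auto.
Qed.

Lemma definable_pair t s :
  definable_fun t → definable_fun s → definable_fun (fun e => pair (t e) (s e)).
Proof. intros; unfold pair, singleton; auto using definable_upair. Qed.

Lemma comprehension_at Q e : definable Q → assignment e →
  ∃ A, A ∈ classes M ∧ ∀ x, x ∈ A ↔ x ∈ sets M ∧ Q (scons x e).
Proof.
  intros (φ & c & Hc & H) He.
  destruct (GB_class_existence (model_GB hM) φ He Hc) as (A & HA & K).
  exists A; split; trivial; intros x; split.
  - intros Hx; assert (x ∈ sets M) by (eapply in_class_in_M; eauto).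
    split; trivial; apply H; [now apply scons_assignment|]; now apply K.
  - intros [Hx HQ]; apply K; trivial; apply H; trivial.
    now apply scons_assignment.
Qed.

Lemma comprehension Q : definable1 Q →
  ∃ A, A ∈ classes M ∧ ∀ x, x ∈ A ↔ x ∈ sets M ∧ Q x.
Proof.
  intros H; apply (comprehension_at (e := fun _ => emptyset) H).
  intros _; apply empty_in_M.
Qed.

Lemma sep_class Q A : A ∈ classes M → definable1 Q → sep Q A ∈ classes M.
Proof.
  intros HA HQ; destruct (@comprehension (fun x => x ∈ A ∧ Q x)) as (B & HB & H).
  { apply definable_and; trivial; apply definable_class; trivial; apply definable_var. }
  replace (sep Q A) with B; trivial; apply mem_ext; intros x.
  rewrite H, mem_sep; split; [tauto|].
  intros [Hx ?]; repeat split; trivial; eapply in_class_in_M; eauto.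
Qed.

Lemma sep_set Q a : a ∈ sets M → definable1 Q → sep Q a ∈ sets M.
Proof.
  intros Ha HQ.
  destruct (comprehension HQ) as (A & HA & H).
  destruct (GB_separation (model_GB hM) Ha HA) as (d & Hd & K).
  replace (sep Q a) with d; trivial.
  apply class_ext; [now apply sets_are_classes| |].
  - intros x Hx; apply mem_sep in Hx as [Hx _]; eapply in_set_in_M; eauto.
  - intros x Hx; rewrite K, H, mem_sep by trivial; tauto.
Qed.

(** Separation after Collection leaves in the bounding set only values that are
    attained.  The union of such a set therefore inherits every property of the
    values that passes to unions. *)
Lemma collection a (R : V → V → Prop) : a ∈ sets M → definable2 R →
  (∀ x, x ∈ a → ∃ y, y ∈ sets M ∧ R x y) →
  ∃ b, b ∈ sets M ∧ (∀ y, y ∈ b → ∃ x, x ∈ a ∧ R x y) ∧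
    ∀ x, x ∈ a → ∃ y, y ∈ b ∧ R x y.
Proof.
  intros Ha HR H.
  destruct (@comprehension (fun z => ∃ x y, z = pair x y ∧ R x y)) as (A & HA & K).
  { apply definable_ext with
      (fun e => ∃ x, x ∈ sets M ∧ ∃ y, y ∈ sets M ∧ e 0 = pair x y ∧ R x y).
    2: { intros e He; split;
           [intros (x & y & E & r)|intros (x & _ & y & _ & H'); now exists x, y].
         destruct (@pair_in_M_inv x y); [rewrite <- E; apply He|].
         exists x; split; trivial; now exists y. }
    assert (T : definable (fun e => e 0 ∈ sets M)).
    { apply definable_ext with (fun e => e 0 = e 0);
        [apply definable_eq; apply definable_var|intros e He; split; auto]. }
    apply definable_ex; [|now intros e _ x []]; cbv beta.
    apply definable_and; trivial; apply definable_ex; [|now intros e _ x []]; cbv beta.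
    apply definable_and; trivial; apply definable_and.
    - apply definable_eq; [|apply definable_pair]; apply definable_var.
    - apply (definable2_app (t := fun e => e 1) (s := fun e => e 0)); trivial;
        apply definable_var. }
  destruct (@GB_collection _ _ (model_GB hM) a A) as (b & Hb & L); trivial.
  { intros x Hx Hxa; destruct (H x Hxa) as (y & Hy & r).
    exists y; split; trivial; apply K; split; [|eauto].
    apply pair_in_M; trivial; eapply in_set_in_M; eauto. }
  exists (sep (fun y => ∃ x, x ∈ a ∧ R x y) b).
  assert (Q : ∀ x y, pair x y ∈ A → R x y).
  { intros x y Hxy; apply K in Hxy as (_ & x' & y' & E & r).
    now apply pair_inj in E as [-> ->]. }
  split; [|split].
  - apply sep_set; trivial.
    apply definable_ex.
    + apply definable_and; [apply definable_class|]; [apply definable_var|now apply sets_are_classes|].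
      apply (definable2_app (t := fun e => e 0) (s := fun e => e 1)); trivial;
        apply definable_var.
    + intros e He x [Hx _]; eapply in_set_in_M; eauto.
  - intros y Hy; apply mem_sep in Hy; tauto.
  - intros x Hx; destruct (L x) as (y & Hy & Hyb & r); trivial.
    { eapply in_set_in_M; eauto. }
    exists y; rewrite mem_sep; apply Q in r; repeat split; trivial; eauto.
Qed.

Lemma definable_in_sets t : definable_fun t → definable (fun e => t e ∈ sets M).
Proof.
  intros T; apply definable_ext with (fun e => t e = t e).
  - now apply definable_eq.
  - intros e He; split; [trivial|intros _; now apply T].
Qed.

Lemma pair_in_class_l a b A : pair a b ∈ A → A ∈ classes M → a ∈ sets M.
Proof. intros H HA; apply (pair_in_M_inv (in_class_in_M H HA)). Qed.

Lemma pair_in_class_r a b A : pair a b ∈ A → A ∈ classes M → b ∈ sets M.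
Proof. intros H HA; apply (pair_in_M_inv (in_class_in_M H HA)). Qed.

Lemma pair_eq_in_M_l z a b : z = pair a b → z ∈ sets M → a ∈ sets M.
Proof. intros -> H; apply (pair_in_M_inv H). Qed.

Lemma pair_eq_in_M_r z a b : z = pair a b → z ∈ sets M → b ∈ sets M.
Proof. intros -> H; apply (pair_in_M_inv H). Qed.

(** * Symmetric systems *)

Variable S : system V.
Hypothesis hS : is_symmetric_system M S.

Notation P := (conds S).

Lemma conds_class : P ∈ classes M.
Proof. apply (sys_classes hS). Qed.
Lemma ord_class : ord S ∈ classes M.
Proof. apply (sys_classes hS). Qed.
Lemma C_G_class : C_G S ∈ classes M.
Proof. apply (sys_classes hS). Qed.
Lemma C_F_class : C_F S ∈ classes M.
Proof. apply (sys_classes hS). Qed.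

Lemma leq_conds p q : leq S p q → p ∈ P ∧ q ∈ P.
Proof. intros H; apply (preorder_field (sys_preorder hS)) in H; now apply pair_in_prod in H. Qed.

Lemma leq_left p q : leq S p q → p ∈ P.
Proof. intros H; apply (leq_conds H). Qed.

Lemma leq_right p q : leq S p q → q ∈ P.
Proof. intros H; apply (leq_conds H). Qed.

Lemma leq_refl p : p ∈ P → leq S p p.
Proof. apply (preorder_refl (sys_preorder hS)). Qed.

Lemma leq_trans p q r : leq S p q → leq S q r → leq S p r.
Proof. apply (preorder_trans (sys_preorder hS)). Qed.

Lemma cond_in_M p : p ∈ P → p ∈ sets M.
Proof. intros H; exact (in_class_in_M H conds_class). Qed.

Lemma leq_in_M_l p q : leq S p q → p ∈ sets M.
Proof. intros H; exact (cond_in_M (leq_left H)). Qed.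

Lemma leq_in_M_r p q : leq S p q → q ∈ sets M.
Proof. intros H; exact (cond_in_M (leq_right H)). Qed.

Lemma definable_leq t s :
  definable_fun t → definable_fun s → definable (fun e => leq S (t e) (s e)).
Proof.
  intros T T'; apply (definable_class (t := fun e => pair (t e) (s e))).
  - now apply definable_pair.
  - apply ord_class.
Qed.

Create HintDb in_model.
#[local] Hint Resolve conds_class ord_class C_G_class C_F_class sets_are_classes
  cond_in_M pair_in_M empty_in_M : in_model.

Ltac in_model := first
  [ assumption
  | solve [auto 3 with in_model]
  | match goal with
    | H : leq S ?a _ |- ?a ∈ sets M => exact (leq_in_M_l H)
    | H : leq S _ ?a |- ?a ∈ sets M => exact (leq_in_M_r H)
    | H : pair ?a _ ∈ _ |- ?a ∈ sets M =>
        apply (pair_in_class_l H); solve [auto 3 with in_model]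
    | H : pair _ ?a ∈ _ |- ?a ∈ sets M =>
        apply (pair_in_class_r H); solve [auto 3 with in_model]
    | H : pair _ (pair ?a ?b) ∈ _ |- _ =>
        match goal with
        | |- a ∈ sets M => idtac
        | |- b ∈ sets M => idtac
        end;
        apply (pair_in_M_inv (a := a) (b := b)), (pair_in_class_r H);
        solve [auto 3 with in_model]
    | H : _ = pair ?a _ |- ?a ∈ sets M => apply (pair_eq_in_M_l H); in_model
    | H : _ = pair _ ?a |- ?a ∈ sets M => apply (pair_eq_in_M_r H); in_model
    | H : ?a ∈ _ |- ?a ∈ sets M =>
        apply (in_class_in_M H); solve [auto 3 with in_model]
    end ].

(** Solves the boundedness premises of [definable_ex] and [definable_all]: the
    quantified variable occurs in an atomic formula that puts it in the model. *)
Ltac bounded :=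
  let H := fresh in
  let e := fresh "e" in
  let He := fresh in
  intros e He ? H; cbv beta in H; unfold assignment in He;
  repeat match goal with
  | H : _ ∧ _ |- _ => destruct H
  | H : ∃ _, _ |- _ => destruct H
  | H : ¬ (?A → ?B) |- _ =>
      match type of A with Prop => apply imply_to_and in H; destruct H end
  | H : ¬ (∀ x, @?Q x) |- _ => apply not_all_ex_not in H; destruct H
  end; in_model.

Ltac definability :=
  cbv beta;
  match goal with
  | H : definable ?Q |- definable ?Q => exact H
  | |- definable (fun e => @?Q e ∧ @?R e) => apply (definable_and (Q := Q) (R := R)); definability
  | |- definable (fun e => @?Q e ∨ @?R e) => apply (definable_or (Q := Q) (R := R)); definability
  | |- definable (fun e => @?Q e ↔ @?R e) => apply (definable_iff (Q := Q) (R := R)); definability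
  | |- definable (fun e => ¬ @?Q e) => apply (definable_not (Q := Q)); definability
  | |- definable (fun e => @?Q e → @?R e) => apply (definable_imp (Q := Q) (R := R)); definability
  | |- definable (fun e => ∃ a, @?Q e a) =>
      apply (definable_ex (Q := fun a e => Q e a)); [definability|try bounded]
  | |- definable (fun e => ∀ a, @?Q e a) =>
      apply (definable_all (Q := fun a e => Q e a)); [definability|try bounded]
  | |- definable (fun e => leq S (@?t e) (@?s e)) =>
      apply (definable_leq (t := t) (s := s)); definability
  | |- definable (fun e => @?t e ∈ sets M) =>
      apply (definable_in_sets (t := t)); definability
  | |- definable (fun e => @?t e ∈ ?A) =>
      apply (definable_class (t := t) (A := A)); [definability|try in_model]
  | |- definable (fun e => @?t e ∈ @?s e) =>
      apply (definable_mem (t := t) (s := s)); definability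
  | |- definable (fun e => @?t e = @?s e) =>
      apply (definable_eq (t := t) (s := s)); definability
  | |- definable_fun (fun e => e ?i) => apply (definable_var i)
  | |- definable_fun (fun _ => ?a) => apply (definable_const (a := a)); try in_model
  | |- definable_fun (fun e => pair (@?t e) (@?s e)) =>
      apply (definable_pair (t := t) (s := s)); definability
  | H : definable1 ?Q |- definable (fun e => ?Q (@?t e)) =>
      apply (definable1_app (t := t) H); definability
  | H : definable2 ?Q |- definable (fun e => ?Q (@?t e) (@?s e)) =>
      apply (definable2_app (t := t) (s := s) H); definability
  | H : definable3 ?Q |- definable (fun e => ?Q (@?t e) (@?s e) (@?u e)) =>
      apply (definable3_app (t := t) (s := s) (u := u) H); definability
  | _ => idtac
  end.

Lemma dom_class r : r ∈ classes M → dom r ∈ classes M.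
Proof.
  intros Hr; destruct (@comprehension (fun x => ∃ y, pair x y ∈ r)) as (A & HA & H).
  { unfold definable1; definability. }
  replace (dom r) with A; trivial; apply mem_ext; intros x.
  rewrite H, domE; split; [tauto|intros [y Hy]; split; [in_model|eauto]].
Qed.

#[local] Hint Resolve dom_class : in_model.

Lemma base_index_dom a d : pair a d ∈ C_F S → d ∈ dom (C_G S).
Proof. intros H; apply (sys_CF hS) in H; now apply pair_in_prod in H. Qed.

Lemma grpE π : π ∈ grp S ↔ ∃ d, d ∈ dom (C_G S) ∧ π = aut S d.
Proof. apply mem_repl. Qed.

Lemma aut_in_grp d : d ∈ dom (C_G S) → aut S d ∈ grp S.
Proof. intros H; apply grpE; eauto. Qed.

Lemma grp_aut π : π ∈ grp S → is_automorphism S π.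
Proof. intros H; apply grpE in H as (d & Hd & ->); now apply (sys_automorphism hS). Qed.

Lemma app_graph π p q : π ∈ grp S → (pair p q ∈ π ↔ p ∈ P ∧ q = app π p).
Proof.
  intros Hπ; apply grp_aut in Hπ.
  assert (E : ∀ p, p ∈ P → pair p (app π p) ∈ π).
  { intros p' Hp; unfold app; apply epsilon_spec.
    destruct (aut_function Hπ Hp) as (q' & Hq & _); eauto. }
  split.
  - intros H; assert (Hp : p ∈ P).
    { apply (aut_field Hπ) in H; now apply pair_in_prod in H. }
    split; trivial; destruct (aut_function Hπ Hp) as (q' & _ & U).
    rewrite <- (U q H); apply U; auto.
  - intros [Hp ->]; auto.
Qed.

Lemma app_in π p : π ∈ grp S → p ∈ P → app π p ∈ P.
Proof.
  intros Hπ Hp; assert (H : pair p (app π p) ∈ π) by now apply app_graph.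
  apply grp_aut in Hπ; apply (aut_field Hπ) in H; now apply pair_in_prod in H.
Qed.

Lemma app_leq π p q : π ∈ grp S → p ∈ P → q ∈ P →
  (leq S p q ↔ leq S (app π p) (app π q)).
Proof.
  intros Hπ Hp Hq; apply (aut_order (grp_aut Hπ)); now apply app_graph.
Qed.

(** A member of the group is determined by the function it induces on the
    conditions, so identities between products of automorphisms can be checked
    pointwise. *)
Lemma grp_ext π σ : π ∈ grp S → σ ∈ grp S →
  (∀ p, p ∈ P → app π p = app σ p) → π = σ.
Proof.
  intros Hπ Hσ H; apply mem_ext; intros z; split; intros Hz.
  - assert (K := aut_field (grp_aut Hπ) Hz); apply prodE in K as (p & q & Hp & _ & ->).
    apply app_graph in Hz as [_ ->]; trivial; apply app_graph; auto.
  - assert (K := aut_field (grp_aut Hσ) Hz); apply prodE in K as (p & q & Hp & _ & ->).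
    apply app_graph in Hz as [_ ->]; trivial; apply app_graph; auto.
    split; trivial; symmetry; auto.
Qed.

Lemma grp_id : aut_id S ∈ grp S.
Proof. apply (subgroup_id (sys_group hS)). Qed.
Lemma grp_inv π : π ∈ grp S → aut_inv S π ∈ grp S.
Proof. apply (subgroup_inv (sys_group hS)). Qed.
Lemma grp_comp π σ : π ∈ grp S → σ ∈ grp S → aut_comp S π σ ∈ grp S.
Proof. apply (subgroup_comp (sys_group hS)). Qed.

Lemma app_id p : p ∈ P → app (aut_id S) p = p.
Proof.
  intros Hp; symmetry; apply (app_graph p p grp_id).
  apply mem_sep; split; [now apply pair_in_prod|now exists p].
Qed.

Lemma app_comp π σ p : π ∈ grp S → σ ∈ grp S → p ∈ P →
  app (aut_comp S π σ) p = app π (app σ p).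
Proof.
  intros Hπ Hσ Hp; symmetry; apply (app_graph p _ (grp_comp Hπ Hσ)).
  apply mem_sep; split; [apply pair_in_prod; auto using app_in|].
  exists p, (app σ p), (app π (app σ p)); rewrite !app_graph by trivial.
  auto using app_in.
Qed.

Lemma app_invK π p : π ∈ grp S → p ∈ P → app (aut_inv S π) (app π p) = p.
Proof.
  intros Hπ Hp; symmetry; apply (app_graph _ p (grp_inv Hπ)).
  apply mem_sep; split; [apply pair_in_prod; auto using app_in|].
  exists p, (app π p); rewrite app_graph by trivial; auto.
Qed.

Lemma app_Kinv π p : π ∈ grp S → p ∈ P → app π (app (aut_inv S π) p) = p.
Proof.
  intros Hπ Hp; assert (H : pair p (app (aut_inv S π) p) ∈ aut_inv S π).
  { apply app_graph; auto using grp_inv. }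
  apply mem_sep in H as (_ & q & p' & E & H); apply pair_inj in E as [<- <-].
  apply app_graph in H as [_ H]; auto.
Qed.

Lemma comp_inv π : π ∈ grp S → aut_comp S (aut_inv S π) π = aut_id S.
Proof.
  intros Hπ; apply grp_ext; auto using grp_comp, grp_inv, grp_id.
  intros p Hp; rewrite app_comp, app_invK, app_id; auto using grp_inv.
Qed.

Lemma C_G_app d p q :
  pair d (pair p q) ∈ C_G S ↔ d ∈ dom (C_G S) ∧ p ∈ P ∧ q = app (aut S d) p.
Proof.
  assert (E : pair d (pair p q) ∈ C_G S ↔ pair p q ∈ aut S d).
  { unfold aut; rewrite mem_sep; split; [|tauto].
    intros H; split; trivial; apply (sys_CG hS) in H; now apply pair_in_prod in H. }
  split.
  - intros H; assert (Hd : d ∈ dom (C_G S)) by (apply domE; eauto).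
    apply E, app_graph in H; auto using aut_in_grp.
  - intros (Hd & H); apply E, app_graph; auto using aut_in_grp.
Qed.

Lemma baseE a π : π ∈ base S a ↔ ∃ d, pair a d ∈ C_F S ∧ π = aut S d.
Proof.
  unfold base; rewrite mem_repl; split.
  - intros (d & Hd & ->); apply mem_sep in Hd as [_ Hd]; eauto.
  - intros (d & Hd & ->); exists d; rewrite mem_sep; eauto using base_index_dom.
Qed.

Lemma base_grp a π : π ∈ base S a → π ∈ grp S.
Proof.
  intros H; apply baseE in H as (d & Hd & ->); eauto using aut_in_grp, base_index_dom.
Qed.

(** The definability premise concerns indices d and not the automorphisms,
    since automorphisms may be proper classes: the members of a group in
    the filter have to be parametrized by a class of indices. *)
Lemma in_filter_intro (Q : V → Prop) :
  definable1 (fun d => d ∈ dom (C_G S) ∧ Q (aut S d)) →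
  is_subgroup S (sep Q (grp S)) →
  (∃ a, a ∈ dom (C_F S) ∧ ∀ π, π ∈ base S a → Q π) →
  in_filter M S (sep Q (grp S)).
Proof.
  intros D H (a & Ha & K); split; trivial; split.
  - destruct (comprehension D) as (C & HC & E); exists C; split; trivial.
    split; [intros d Hd; apply E in Hd; tauto|].
    apply mem_ext; intros π; rewrite mem_sep, grpE, mem_repl; split.
    + intros ((d & Hd & ->) & q); exists d; split; trivial; apply E; split; auto; in_model.
    + intros (d & Hd & ->); apply E in Hd as (_ & ? & ?); eauto.
  - exists a; split; trivial; intros π Hπ; apply mem_sep; eauto using base_grp.
Qed.

(** * The action on names *)

Lemma actE (π x z : V) :
  z ∈ act π x ↔ ∃ y p : V, pair y p ∈ x ∧ z = pair (act π y) (app π p).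
Proof.
  unfold act; rewrite mem_name_rec; split.
  - intros (y & p & Hy & _ & E); now exists y, p.
  - intros (y & p & Hy & E); now exists y, p.
Qed.

Lemma is_name_inv x z : is_name M S x → z ∈ x →
  ∃ y p, z = pair y p ∧ y ∈ sets M ∧ p ∈ P ∧ is_name M S y.
Proof.
  intros [x' H K] Hz; destruct (H z Hz) as (y & p & Hp & ->).
  destruct (K _ _ Hz); exists y, p; auto.
Qed.

Lemma is_name_pair x y p : is_name M S x → pair y p ∈ x →
  y ∈ sets M ∧ p ∈ P ∧ is_name M S y.
Proof.
  intros H Hz; destruct (is_name_inv H Hz) as (y' & p' & E & K).
  now apply pair_inj in E as [<- <-].
Qed.

Lemma name_ind (Q : V → Prop) :
  (∀ x, is_name M S x → (∀ y p, pair y p ∈ x → Q y) → Q x) →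
  ∀ x, is_name M S x → Q x.
Proof.
  intros H x; induction x as [x IH] using (well_founded_ind (below_wf (V := V))).
  intros Hx; apply H; trivial; intros y p Hy; apply IH; [now exists p|].
  apply (is_name_pair Hx Hy).
Qed.

Lemma act_id x : is_name M S x → act (aut_id S) x = x.
Proof.
  revert x; apply name_ind; intros x Hx IH; apply mem_ext; intros z; rewrite actE; split.
  - intros (y & p & Hy & ->); rewrite (IH _ _ Hy), app_id; trivial.
    apply (is_name_pair Hx Hy).
  - intros Hz; destruct (is_name_inv Hx Hz) as (y & p & -> & _ & Hp & _).
    exists y, p; rewrite (IH _ _ Hz), app_id; auto.
Qed.

Lemma act_comp π σ x : π ∈ grp S → σ ∈ grp S → is_name M S x →
  act (aut_comp S π σ) x = act π (act σ x).
Proof.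
  intros Hπ Hσ; revert x; apply name_ind; intros x Hx IH.
  apply mem_ext; intros z; rewrite !actE; split.
  - intros (y & p & Hy & ->); exists (act σ y), (app σ p); rewrite actE.
    split; [eauto|]; rewrite (IH _ _ Hy), app_comp; trivial; apply (is_name_pair Hx Hy).
  - intros (y & p & Hy & ->); apply actE in Hy as (v & r & Hv & E).
    apply pair_inj in E as [-> ->]; exists v, r; split; trivial.
    rewrite (IH _ _ Hv), app_comp; trivial; apply (is_name_pair Hx Hv).
Qed.

Lemma act_invK π x : π ∈ grp S → is_name M S x → act (aut_inv S π) (act π x) = x.
Proof.
  intros Hπ Hx; rewrite <- act_comp, comp_inv, act_id; auto using grp_inv.
Qed.

Lemma sym_subgroup x : is_name M S x → is_subgroup S (sym S x).
Proof.
  intros Hx; unfold sym; split.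
  - intros π Hπ; apply mem_sep in Hπ; tauto.
  - apply mem_sep; split; [apply grp_id|now apply act_id].
  - intros π σ Hπ Hσ; apply mem_sep in Hπ as [Hπ E]; apply mem_sep in Hσ as [Hσ E'].
    apply mem_sep; split; [now apply grp_comp|].
    rewrite act_comp, E', E; auto.
  - intros π Hπ; apply mem_sep in Hπ as [Hπ E]; apply mem_sep; split; [now apply grp_inv|].
    rewrite <- E at 1; now apply act_invK.
Qed.

(** A first-order replacement for the recursion that defines the action of
    [aut S d]: f is closed downwards, and each of its pairs obeys the recursion
    clause relative to f.  By induction, f is then a fragment of the action. *)
Definition coherent (d f : V) : Prop :=
  ∀ u u', pair u u' ∈ f →
    (∀ z, z ∈ u → ∃ v p v' q, z = pair v p ∧ pair v v' ∈ f ∧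
       pair d (pair p q) ∈ C_G S ∧ pair v' q ∈ u') ∧
    (∀ z, z ∈ u' → ∃ v p v' q, z = pair v' q ∧ pair v v' ∈ f ∧
       pair d (pair p q) ∈ C_G S ∧ pair v p ∈ u).

Lemma coherent_definable : definable2 coherent.
Proof. unfold definable2, coherent; definability. Qed.

Lemma coherent_act d f u u' : coherent d f → pair u u' ∈ f → u' = act (aut S d) u.
Proof.
  intros Hf; revert u'; induction u as [u IH] using (well_founded_ind (below_wf (V := V))).
  intros u' Hu; destruct (Hf u u' Hu) as [K L]; apply mem_ext; intros z; rewrite actE; split.
  - intros Hz; destruct (L z Hz) as (v & p & v' & q & -> & Hv & Hp & Hvp).
    exists v, p; split; trivial.
    apply C_G_app in Hp as (_ & _ & ->); f_equal; apply IH; trivial; now exists p.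
  - intros (y & r & Hy & ->).
    destruct (K _ Hy) as (v & p & v' & q & E & Hv & Hp & Hvp).
    apply pair_inj in E as [<- <-].
    apply C_G_app in Hp as (_ & _ & ->).
    replace (act (aut S d) y) with v'; trivial; apply IH; trivial; now exists r.
Qed.

Definition act_graph (d x y : V) : Prop :=
  ∃ f, f ∈ sets M ∧ coherent d f ∧ pair x y ∈ f.

Lemma act_graph_definable : definable3 act_graph.
Proof.
  assert (H := coherent_definable); unfold definable3, act_graph; definability.
Qed.

(** Collection gives coherent sets for all elements of x, and their union g is
    coherent because coherence passes to unions.  A second use of Collection, on
    the relation read off from g, shows that the moved name is a set of the
    model; adding its pair with x to g keeps coherence. *)
Lemma act_graph_ex d x : d ∈ dom (C_G S) → is_name M S x → x ∈ sets M →
  act_graph d x (act (aut S d) x).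
Proof.
  intros Hd; assert (dM : d ∈ sets M) by in_model.
  assert (Dc := coherent_definable).
  revert x; apply (name_ind (Q := fun x => x ∈ sets M → _)); intros x Hx IH xM.
  destruct (@collection x (fun z f => coherent d f ∧
    ∃ y p y', z = pair y p ∧ pair y y' ∈ f)) as (b & bM & Hb & Hb'); trivial.
  { unfold definable2; definability. }
  { intros z Hz; destruct (is_name_inv Hx Hz) as (y & p & -> & yM & Hp & Hy).
    destruct (IH y p Hz yM) as (f & fM & Hf & Hyf); exists f; eauto 7. }
  set (g := union b); assert (gM : g ∈ sets M) by now apply union_in_M.
  assert (Hg : ∀ y p, pair y p ∈ x → pair y (act (aut S d) y) ∈ g).
  { intros y p Hy; destruct (Hb' _ Hy) as (f & Hf & Cf & y' & p' & y'' & E & Hy').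
    apply pair_inj in E as [<- <-]; apply mem_union; exists f; split; trivial.
    now rewrite <- (coherent_act Cf Hy'). }
  assert (Cg : coherent d g).
  { intros u u' Hu; apply mem_union in Hu as (f & Hf & Hu).
    destruct (Hb f Hf) as (_ & _ & Cf & _); destruct (Cf u u' Hu) as [K L].
    split; intros z Hz.
    - destruct (K z Hz) as (v & p & v' & q & ? & ? & ? & ?).
      exists v, p, v', q; repeat split; trivial; apply mem_union; eauto.
    - destruct (L z Hz) as (v & p & v' & q & ? & ? & ? & ?).
      exists v, p, v', q; repeat split; trivial; apply mem_union; eauto. }
  assert (Mx : act (aut S d) x ∈ sets M).
  { destruct (@collection x (fun z w => ∃ y p y' q, z = pair y p ∧ pair y y' ∈ g ∧
      pair d (pair p q) ∈ C_G S ∧ w = pair y' q)) as (c & cM & Hc & Hc'); trivial.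
    { unfold definable2; definability. }
    { intros z Hz; destruct (is_name_inv Hx Hz) as (y & p & -> & yM & Hp & Hy).
      assert (Hy' := Hg _ _ Hz).
      exists (pair (act (aut S d) y) (app (aut S d) p)); split.
      - apply pair_in_M; [in_model|apply cond_in_M; auto using app_in, aut_in_grp].
      - exists y, p, (act (aut S d) y), (app (aut S d) p); rewrite C_G_app; auto 7. }
    replace (act (aut S d) x) with c; trivial; apply mem_ext; intros z; rewrite actE; split.
    - intros Hz; destruct (Hc z Hz) as (z' & Hz' & y & p & y' & q & -> & Hy & Hp & ->).
      apply C_G_app in Hp as (_ & _ & ->); exists y, p.
      now rewrite (coherent_act Cg Hy).
    - intros (y & p & Hy & ->).
      destruct (Hc' _ Hy) as (w & Hw & y0 & p0 & y' & q & E & Hy' & Hp & ->).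
      apply pair_inj in E as [<- <-].
      apply C_G_app in Hp as (_ & _ & ->); now rewrite <- (coherent_act Cg Hy'). }
  set (x' := act (aut S d) x) in *.
  exists (union (upair g (singleton (pair x x')))).
  assert (U : ∀ z, z ∈ union (upair g (singleton (pair x x'))) ↔ z ∈ g ∨ z = pair x x').
  { intros z; rewrite mem_union; split.
    - intros (y & Hy & Hz); apply mem_upair in Hy as [-> | ->]; auto.
      right; now apply singletonE.
    - intros [Hz | ->]; [exists g|exists (singleton (pair x x'))];
        rewrite mem_upair, ?singletonE; auto. }
  split; [|split].
  - apply union_in_M, upair_in_M; trivial; apply upair_in_M; now apply pair_in_M.
  - intros u u' Hu; apply U in Hu as [Hu | E].
    + destruct (Cg u u' Hu) as [K L]; split; intros z Hz.
      * destruct (K z Hz) as (v & p & v' & q & ? & ? & ? & ?).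
        exists v, p, v', q; rewrite U; auto.
      * destruct (L z Hz) as (v & p & v' & q & ? & ? & ? & ?).
        exists v, p, v', q; rewrite U; auto.
    + apply pair_inj in E as [-> ->]; split; intros z Hz.
      * destruct (is_name_inv Hx Hz) as (y & p & -> & yM & Hp & Hy).
        exists y, p, (act (aut S d) y), (app (aut S d) p); rewrite U, C_G_app.
        repeat split; eauto; apply actE; eauto.
      * apply actE in Hz as (y & p & Hy & ->).
        exists y, p, (act (aut S d) y), (app (aut S d) p); rewrite U, C_G_app.
        repeat split; eauto; apply (is_name_pair Hx Hy).
  - apply U; now right.
Qed.

Lemma act_graphE d x y : d ∈ dom (C_G S) → is_name M S x → x ∈ sets M →
  (act_graph d x y ↔ y = act (aut S d) x).
Proof.
  intros Hd Hx xM; split; [|intros ->; now apply act_graph_ex].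
  intros (f & _ & Cf & Hy); exact (coherent_act Cf Hy).
Qed.

Lemma act_in_M π x : π ∈ grp S → is_name M S x → x ∈ sets M → act π x ∈ sets M.
Proof.
  intros Hπ Hx xM; apply grpE in Hπ as (d & Hd & ->).
  destruct (act_graph_ex Hd Hx xM) as (f & fM & _ & H).
  in_model.
Qed.

Lemma act_name π x : π ∈ grp S → is_name M S x → is_name M S (act π x).
Proof.
  intros Hπ; revert x; apply name_ind; intros x Hx IH; constructor.
  - intros z Hz; apply actE in Hz as (y & p & Hy & ->).
    exists (act π y), (app π p); split; trivial.
    apply app_in; trivial; apply (is_name_pair Hx Hy).
  - intros y' q Hz; apply actE in Hz as (y & p & Hy & E); apply pair_inj in E as [-> ->].
    destruct (is_name_pair Hx Hy) as (yM & Hp & Ny).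
    split; [now apply act_in_M|eauto].
Qed.

(** * Hereditarily symmetric names *)

Lemma hs_name x : hereditarily_symmetric M S x → is_name M S x.
Proof. now intros []. Qed.

Lemma hs_base x : hereditarily_symmetric M S x →
  ∃ a, a ∈ dom (C_F S) ∧ ∀ π, π ∈ base S a → act π x = x.
Proof.
  intros [x' _ (_ & _ & a & Ha & H) _]; exists a; split; trivial.
  intros π Hπ; apply H, mem_sep in Hπ; tauto.
Qed.

Lemma HSE x : x ∈ HS M S ↔ x ∈ sets M ∧ hereditarily_symmetric M S x.
Proof. apply mem_sep. Qed.

Lemma hs_pair x y p : hereditarily_symmetric M S x → pair y p ∈ x → y ∈ HS M S ∧ p ∈ P.
Proof.
  intros [x' N _ H] Hy; destruct (is_name_pair N Hy) as (yM & Hp & _).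
  split; trivial; apply HSE; eauto.
Qed.

Lemma hs_inv x z : hereditarily_symmetric M S x → z ∈ x →
  ∃ y p, z = pair y p ∧ y ∈ HS M S ∧ p ∈ P.
Proof.
  intros Hx Hz; destruct (is_name_inv (hs_name Hx) Hz) as (y & p & -> & _).
  exists y, p; split; trivial; exact (hs_pair Hx Hz).
Qed.

Lemma HS_in_M x : x ∈ HS M S → x ∈ sets M.
Proof. rewrite HSE; tauto. Qed.

Lemma HS_hs x : x ∈ HS M S → hereditarily_symmetric M S x.
Proof. rewrite HSE; tauto. Qed.

Lemma HS_name x : x ∈ HS M S → is_name M S x.
Proof. intros H; now apply hs_name, HS_hs. Qed.

Lemma HS_pair x y p : x ∈ HS M S → pair y p ∈ x → y ∈ HS M S ∧ p ∈ P.
Proof. intros H; apply hs_pair; now apply HS_hs. Qed.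

Lemma HS_ind (Q : V → Prop) :
  (∀ x, x ∈ HS M S → (∀ y p, pair y p ∈ x → Q y) → Q x) → ∀ x, x ∈ HS M S → Q x.
Proof.
  intros H x; induction x as [x IH] using (well_founded_ind (below_wf (V := V))).
  intros Hx; apply H; trivial; intros y p Hy; apply IH; [now exists p|].
  apply (HS_pair Hx Hy).
Qed.

Lemma sym_in_filter x : is_name M S x → x ∈ sets M →
  (∃ a, a ∈ dom (C_F S) ∧ ∀ π, π ∈ base S a → act π x = x) →
  in_filter M S (sym S x).
Proof.
  intros Hx xM H; apply in_filter_intro; trivial; [|now apply sym_subgroup].
  assert (D := act_graph_definable).
  apply definable_ext with (fun e => e 0 ∈ dom (C_G S) ∧ act_graph (e 0) x x).
  { definability. }
  intros e He; split; intros [Hd K]; split; trivial.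
  - apply act_graphE; auto.
  - apply act_graphE in K; auto.
Qed.

(** A set of the model containing, with each name, the names below it and a
    witness of its symmetry.  The names in HS are the members of such sets, which
    is a first-order condition. *)
Definition closed_symmetric (t : V) : Prop :=
  ∀ x, x ∈ t →
    (∀ z, z ∈ x → ∃ y p, z = pair y p ∧ y ∈ t ∧ p ∈ P) ∧
    ∃ a, a ∈ dom (C_F S) ∧ ∀ d, pair a d ∈ C_F S → act_graph d x x.

Lemma closed_symmetric_definable : definable1 closed_symmetric.
Proof.
  assert (D := act_graph_definable); unfold definable1, closed_symmetric; definability.
Qed.

Lemma closed_symmetric_HS t x : t ∈ sets M → closed_symmetric t → x ∈ t → x ∈ HS M S.
Proof.
  intros tM Ht; induction x as [x IH] using (well_founded_ind (below_wf (V := V))).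
  intros Hx; assert (xM : x ∈ sets M) by in_model.
  destruct (Ht x Hx) as (K & a & Ha & L).
  assert (HH : ∀ y p, pair y p ∈ x → y ∈ HS M S).
  { intros y p Hy; apply IH; [now exists p|].
    destruct (K _ Hy) as (y' & p' & E & H & _); now apply pair_inj in E as [<- <-]. }
  assert (N : is_name M S x).
  { constructor.
    - intros z Hz; destruct (K z Hz) as (y & p & ? & _ & ?); eauto.
    - intros y p Hy; apply HH in Hy; auto using HS_in_M, HS_name. }
  apply HSE; split; trivial; constructor; trivial.
  - apply sym_in_filter; trivial; exists a; split; trivial.
    intros π Hπ; apply baseE in Hπ as (d & Hd & ->); symmetry.
    apply act_graphE; eauto using base_index_dom.
  - intros y p Hy; apply HH in Hy; now apply HS_hs.
Qed.

Lemma HS_closed_symmetric x : x ∈ HS M S → ∃ t, t ∈ sets M ∧ closed_symmetric t ∧ x ∈ t.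
Proof.
  revert x; apply HS_ind; intros x Hx IH; assert (xM := HS_in_M Hx).
  assert (D := closed_symmetric_definable).
  destruct (@collection x (fun z t => closed_symmetric t ∧
    ∃ y p, z = pair y p ∧ y ∈ t)) as (b & bM & Hb & Hb'); trivial.
  { unfold definable2; definability. }
  { intros z Hz; destruct (hs_inv (HS_hs Hx) Hz) as (y & p & -> & _).
    destruct (IH y p Hz) as (t & tM & Ht & Hy); exists t; eauto 6. }
  exists (union (upair (union b) (singleton x))).
  assert (U : ∀ z, z ∈ union (upair (union b) (singleton x)) ↔
    (∃ t, t ∈ b ∧ z ∈ t) ∨ z = x).
  { intros z; rewrite mem_union; split.
    - intros (y & Hy & Hz); apply mem_upair in Hy as [-> | ->].
      + left; now apply mem_union in Hz.
      + right; now apply singletonE.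
    - intros [Hz | ->]; [exists (union b)|exists (singleton x)];
        rewrite mem_upair, ?singletonE, ?mem_union; auto. }
  split; [|split].
  - apply union_in_M, upair_in_M; [now apply union_in_M|now apply upair_in_M].
  - intros u Hu; apply U in Hu as [(t & Ht & Hu) | ->].
    + destruct (Hb t Ht) as (_ & _ & Ct & _); destruct (Ct u Hu) as [K L]; split; trivial.
      intros z Hz; destruct (K z Hz) as (y & p & ? & ? & ?).
      exists y, p; rewrite U; eauto 6.
    + split.
      * intros z Hz; destruct (hs_inv (HS_hs Hx) Hz) as (y & p & -> & Hy & Hp).
        exists y, p; split; trivial; split; trivial; apply U; left.
        destruct (Hb' _ Hz) as (t & Ht & _ & y' & p' & E & Hyt).
        apply pair_inj in E as [<- <-]; eauto.
      * destruct (hs_base (HS_hs Hx)) as (a & Ha & K); exists a; split; trivial.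
        intros d Hd; apply act_graphE; eauto using base_index_dom, HS_name.
        symmetry; apply K, baseE; eauto.
  - apply U; now right.
Qed.

Lemma HS_class : HS M S ∈ classes M.
Proof.
  assert (D := closed_symmetric_definable).
  destruct (@comprehension (fun x => ∃ t, t ∈ sets M ∧ closed_symmetric t ∧ x ∈ t))
    as (A & HA & H).
  { unfold definable1; definability. }
  replace (HS M S) with A; trivial; apply mem_ext; intros x; rewrite H; split.
  - intros (_ & t & tM & Ht & Hx); eapply closed_symmetric_HS; eauto.
  - intros Hx; split; [now apply HS_in_M|now apply HS_closed_symmetric].
Qed.

(** By normality some base group lies inside the conjugate by π of a base group
    fixing x, and its members fix the moved name. *)
Lemma HS_act π x : π ∈ grp S → x ∈ HS M S → act π x ∈ HS M S.
Proof.
  intros Hπ; revert x; apply HS_ind; intros x Hx IH.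
  assert (N := HS_name Hx); assert (xM := HS_in_M Hx).
  assert (N' := act_name Hπ N); assert (M' := act_in_M Hπ N xM).
  apply HSE; split; trivial; constructor; trivial.
  - apply sym_in_filter; trivial.
    destruct (hs_base (HS_hs Hx)) as (a & Ha & K).
    destruct (proj1 (grpE π) Hπ) as (d & Hd & E).
    destruct (sys_base_normal hS Ha Hd) as (c & Hc & L); exists c; split; trivial.
    intros σ Hσ; apply L, mem_repl in Hσ as (τ & Hτ & ->); rewrite <- E.
    assert (Hτ' := base_grp Hτ).
    rewrite !act_comp, act_invK, K; auto using grp_comp, grp_inv, act_name.
  - intros y' q Hy; apply actE in Hy as (y & p & Hy & E'); apply pair_inj in E' as [-> ->].
    apply HS_hs; eauto.
Qed.

#[local] Hint Resolve HS_class HS_in_M : in_model.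

(** * Invariance of the forcing relation *)

Variable F : V.
Hypothesis hF : is_atomic_forcing M S F.

Lemma F_class : F ∈ classes M.
Proof. apply (f0_class hF). Qed.

#[local] Hint Resolve F_class succ_in_M : in_model.

(** The clause for membership in a set name is the one for membership in a
    class name.  Working with the latter, and with the inclusion [f_sub] built on
    it, leaves equality as the only slice of F in use and treats set and
    class names alike. *)
Definition mem_witness (x Y q : V) : Prop :=
  ∃ z r, pair z r ∈ Y ∧ leq S q r ∧ f0_eq F q x z.

Definition f_sub (p x y : V) : Prop :=
  ∀ z r, pair z r ∈ x → ∀ s, leq S s p → leq S s r →
    ∃ q, leq S q s ∧ f_memC S F z y q.

Lemma f0_mem_memC p x y : p ∈ P → x ∈ HS M S → y ∈ HS M S →
  (f0_mem F p x y ↔ f_memC S F x y p).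
Proof. apply (f0_memE hF). Qed.

Lemma f0_eq_sub p x y : p ∈ P → x ∈ HS M S → y ∈ HS M S →
  (f0_eq F p x y ↔ f_sub p x y ∧ f_sub p y x).
Proof.
  assert (E : ∀ x y, x ∈ HS M S → y ∈ HS M S → p ∈ P → (f0_sub F p x y ↔ f_sub p x y)).
  { clear x y; intros x y Hx Hy Hp; rewrite (f0_subE hF) by trivial; split;
      intros H z r Hz s Hs Hr; destruct (H z r Hz s Hs Hr) as (q & Hq & K);
      exists q; split; trivial;
      apply (@f0_mem_memC q z y (leq_left Hq) (proj1 (HS_pair Hx Hz)) Hy); trivial. }
  intros Hp Hx Hy; rewrite (f0_eqE hF), !E by trivial; reflexivity.
Qed.

Lemma f_memC_mono x Y p q : leq S q p → f_memC S F x Y p → f_memC S F x Y q.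
Proof. intros Hq H r Hr; apply H; exact (leq_trans Hr Hq). Qed.

Lemma f_sub_mono x y p q : leq S q p → f_sub p x y → f_sub q x y.
Proof. intros Hq H z r Hz s Hs; apply (H z r Hz); exact (leq_trans Hs Hq). Qed.

Lemma f0_eq_mono x y p q : x ∈ HS M S → y ∈ HS M S → leq S q p →
  f0_eq F p x y → f0_eq F q x y.
Proof.
  intros Hx Hy Hq; rewrite !f0_eq_sub by eauto using leq_left, leq_right.
  intros []; eauto using f_sub_mono.
Qed.

Lemma leq_app π p q : π ∈ grp S → leq S p q → leq S (app π p) (app π q).
Proof. intros Hπ H; apply app_leq; eauto using leq_left, leq_right. Qed.

Lemma leq_app_inv π p q : π ∈ grp S → p ∈ P → leq S q (app π p) →
  ∃ r, q = app π r ∧ leq S r p.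
Proof.
  intros Hπ Hp H; assert (Hq := leq_left H); exists (app (aut_inv S π) q).
  rewrite app_Kinv by trivial; split; trivial.
  rewrite <- (app_invK Hπ Hp); apply leq_app; auto using grp_inv.
Qed.

Lemma pair_act (π x y p : V) : pair y p ∈ x → pair (act π y) (app π p) ∈ act π x.
Proof. intros H; apply actE; eauto. Qed.

Definition eq_invariant (x y : V) : Prop :=
  ∀ π p, π ∈ grp S → p ∈ P → f0_eq F p x y → f0_eq F (app π p) (act π x) (act π y).

Lemma f_memC_act_of π x Y p : π ∈ grp S → p ∈ P →
  (∀ z r, pair z r ∈ Y → eq_invariant x z) →
  f_memC S F x Y p → f_memC S F (act π x) (act π Y) (app π p).
Proof.
  intros Hπ Hp I H q Hq; destruct (leq_app_inv Hπ Hp Hq) as (q' & -> & Hq').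
  destruct (H q' Hq') as (r & Hr & z & s & Hz & Hs & K).
  exists (app π r); split; [now apply leq_app|].
  exists (act π z), (app π s); repeat split; [now apply pair_act|now apply leq_app|].
  apply (I z s); trivial; exact (leq_left Hr).
Qed.

Lemma f_sub_act_of π x y p : π ∈ grp S → p ∈ P → is_name M S x →
  (∀ z r, pair z r ∈ x → ∀ w s, pair w s ∈ y → eq_invariant z w) →
  f_sub p x y → f_sub (app π p) (act π x) (act π y).
Proof.
  intros Hπ Hp Hx I H z' r' Hz s' Hs Hr.
  apply actE in Hz as (z & r & Hz & E); apply pair_inj in E as [-> ->].
  destruct (is_name_pair Hx Hz) as (_ & rP & _).
  destruct (leq_app_inv Hπ Hp Hs) as (s & -> & Hs').
  assert (Hr' : leq S s r) by (apply (app_leq Hπ (leq_left Hs') rP); trivial).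
  destruct (H z r Hz s Hs' Hr') as (q & Hq & K); exists (app π q).
  split; [now apply leq_app|].
  apply f_memC_act_of; eauto using leq_left.
Qed.

(** Equality of x and y depends on equality of elements of x with elements of y
    in both orders, hence the symmetric induction statement. *)
Lemma f0_eq_act x y : x ∈ HS M S → y ∈ HS M S → eq_invariant x y.
Proof.
  enough (H : ∀ x, x ∈ HS M S → ∀ y, y ∈ HS M S → eq_invariant x y ∧ eq_invariant y x).
  { intros Hx Hy; now apply H. }
  clear x y; apply (HS_ind (Q := fun x => ∀ y, y ∈ HS M S → _)); intros x Hx IH y Hy.
  assert (K : ∀ π p, π ∈ grp S → p ∈ P →
    f_sub p x y ∧ f_sub p y x → f_sub (app π p) (act π x) (act π y) ∧
      f_sub (app π p) (act π y) (act π x)).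
  { intros π p Hπ Hp [H H']; split; apply f_sub_act_of; auto using HS_name.
    - intros z r Hz w s Hw; apply (IH z r Hz); exact (proj1 (HS_pair Hy Hw)).
    - intros w s Hw z r Hz; apply (IH z r Hz); exact (proj1 (HS_pair Hy Hw)). }
  split; intros π p Hπ Hp; rewrite !f0_eq_sub by auto using app_in, HS_act;
    specialize (K π p Hπ Hp); tauto.
Qed.

Lemma f_memC_act π x Y p : π ∈ grp S → p ∈ P → x ∈ HS M S →
  hereditarily_symmetric M S Y →
  f_memC S F x Y p → f_memC S F (act π x) (act π Y) (app π p).
Proof.
  intros Hπ Hp Hx HY; apply f_memC_act_of; trivial.
  intros z r Hz; apply f0_eq_act; trivial; exact (proj1 (hs_pair HY Hz)).
Qed.

Lemma f_sub_act π x y p : π ∈ grp S → p ∈ P → x ∈ HS M S → y ∈ HS M S →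
  f_sub p x y → f_sub (app π p) (act π x) (act π y).
Proof.
  intros Hπ Hp Hx Hy; apply f_sub_act_of; auto using HS_name.
  intros z r Hz w s Hw; apply f0_eq_act.
  - exact (proj1 (HS_pair Hx Hz)).
  - exact (proj1 (HS_pair Hy Hw)).
Qed.

(** * Forcing formulas *)

Variable Γ : nat → V.
Hypothesis hΓ : ∀ k, class_name M S (Γ k).

Lemma Γ_class k : Γ k ∈ classes M.
Proof. apply hΓ. Qed.

Lemma Γ_hs k : hereditarily_symmetric M S (Γ k).
Proof. apply hΓ. Qed.

#[local] Hint Resolve Γ_class : in_model.

(** The formula whose forcing clause is, by computation, that of equality of
    classes. *)
Definition eqC_formula (k l : nat) : formula :=
  let imp φ ψ := Neg (And φ (Neg ψ)) in
  Neg (Ex (Neg (And (imp (MemC 0 k) (MemC 0 l)) (imp (MemC 0 l) (MemC 0 k))))).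

Lemma forces_EqC k l x : forces M S F (EqC k l) x Γ = forces M S F (eqC_formula k l) x Γ.
Proof. reflexivity. Qed.

Lemma formula_EqC_ind (Q : formula → Prop) :
  (∀ i j, Q (Mem i j)) → (∀ i j, Q (Eq i j)) → (∀ i k, Q (MemC i k)) →
  (∀ φ ψ, Q φ → Q ψ → Q (And φ ψ)) → (∀ φ, Q φ → Q (Neg φ)) →
  (∀ φ, Q φ → Q (Ex φ)) → (∀ k l, Q (eqC_formula k l) → Q (EqC k l)) → ∀ φ, Q φ.
Proof.
  intros ? ? ? ? ? ? H φ; induction φ; auto; apply H; unfold eqC_formula; auto 12.
Qed.

Lemma f_memC_definable t s A :
  definable_fun t → definable_fun s → A ∈ classes M →
  definable (fun e => f_memC S F (t e) A (s e)).
Proof.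
  intros T T' HA.
  assert (D : definable2 (fun x p => f_memC S F x A p)).
  { unfold definable2, f_memC, f0_eq; definability. }
  exact (definable2_app D T T').
Qed.

(** The variables are renamed by an arbitrary ρ because under a quantifier the
    bound name precedes the condition and the conditions already quantified. *)
Lemma forces_definable φ : ∀ (ρ : nat → nat) k,
  definable (fun e => forces M S F φ (fun i => e (ρ i)) Γ (e k)).
Proof.
  elim φ using formula_EqC_ind; clear φ; cbn [forces].
  - intros i j ρ k; unfold f0_mem; definability.
  - intros i j ρ k; unfold f0_eq; definability.
  - intros i l ρ k; apply (f_memC_definable (t := fun e => e (ρ i)) (s := fun e => e k));
      in_model || apply definable_var.
  - intros φ ψ H K ρ k; apply definable_and; auto.
  - intros φ H ρ k; unfold f_neg.
    assert (D := H (fun i => 1 + ρ i) 0); definability; trivial.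
  - intros φ H ρ k; unfold f_ex; definability.
    assert (D := H (scons 0 (fun i => 3 + ρ i)) 1).
    eapply definable_ext; [exact D|]; intros e He; cbv beta.
    now rewrite (scons_comp e 0 (fun i => 3 + ρ i)).
  - intros k l H ρ m; exact (H ρ m).
Qed.

Lemma forces_mono φ : ∀ x p q, (∀ i, x i ∈ HS M S) → leq S q p →
  forces M S F φ x Γ p → forces M S F φ x Γ q.
Proof.
  elim φ using formula_EqC_ind; clear φ; cbn [forces].
  - intros i j x p q Hx Hq; rewrite !f0_mem_memC; eauto using leq_left, leq_right, f_memC_mono.
  - intros i j x p q Hx Hq; now apply f0_eq_mono.
  - intros i k x p q Hx; apply f_memC_mono.
  - intros φ ψ H K x p q Hx Hq []; split; eauto.
  - intros φ H x p q Hx Hq K (r & Hr & L); apply K; eauto using leq_trans.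
  - intros φ H x p q Hx Hq K r Hr; apply K; eauto using leq_trans.
  - intros k l H; exact H.
Qed.

(** The number n bounds the variables of φ.  Given infinitely many names,
    a base group is certain to fix only finitely many of them, so the names are
    related by π below n alone.  Beyond n the names y are arbitrary: for y = x only the
    first n names can be assumed fixed by π. *)
Lemma forces_act φ : ∃ n, ∀ π x y p, π ∈ grp S →
  (∀ i, x i ∈ HS M S) → (∀ i, y i ∈ HS M S) →
  (∀ i, i < n → y i = act π (x i)) → (∀ k, k < n → act π (Γ k) = Γ k) →
  p ∈ P → forces M S F φ x Γ p → forces M S F φ y Γ (app π p).
Proof.
  elim φ using formula_EqC_ind; clear φ; cbn [forces].
  - intros i j; exists (1 + i + j); intros π x y p Hπ Hx Hy E _ Hp.
    rewrite !f0_mem_memC, !E by (lia || auto using app_in).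
    apply f_memC_act; auto using HS_hs.
  - intros i j; exists (1 + i + j); intros π x y p Hπ Hx Hy E _ Hp.
    rewrite !E by lia; apply f0_eq_act; auto.
  - intros i k; exists (1 + i + k); intros π x y p Hπ Hx Hy E E' Hp.
    rewrite E by lia; intros K; rewrite <- (E' k) by lia; revert K.
    apply f_memC_act; auto using Γ_hs.
  - intros φ ψ [m H] [n K]; exists (m + n); intros π x y p Hπ Hx Hy E E' Hp [].
    split; [apply H with x|apply K with x]; trivial; intros; apply E || apply E'; lia.
  - intros φ [n H]; exists n; intros π x y p Hπ Hx Hy E E' Hp K (q & Hq & L).
    destruct (leq_app_inv Hπ Hp Hq) as (r & -> & Hr).
    apply K; exists r; split; trivial; rewrite <- (app_invK Hπ (leq_left Hr)).
    apply H with y; auto using grp_inv, app_in.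
    + intros i Hi; rewrite E, act_invK; auto using HS_name.
    + intros k Hk; rewrite <- (E' k) at 1 by trivial; apply act_invK; trivial.
      apply hs_name, Γ_hs.
    + exact (leq_left Hq).
  - intros φ [n H]; exists n; intros π x y p Hπ Hx Hy E E' Hp K q Hq.
    destruct (leq_app_inv Hπ Hp Hq) as (r & -> & Hr).
    destruct (K r Hr) as (s & Hs & z & Hz & L).
    exists (app π s); split; [now apply leq_app|].
    exists (act π z); split; [now apply HS_act|].
    apply H with (scons z x); trivial.
    + now intros [|i]; cbn.
    + intros [|i]; cbn; [now apply HS_act|trivial].
    + intros [|i] Hi; cbn; [trivial|apply E; lia].
    + exact (leq_left Hs).
  - intros k l H; exact H.
Qed.

(** * Meeting symmetric classes *)

(** The properties that make a set of conditions usable against an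
    S-generic filter.  Invariance is asked in one direction only, as base groups
    contain inverses. *)
Definition symmetric_class (E : V → Prop) : Prop :=
  (∃ A, A ∈ classes M ∧ ∀ p, p ∈ P → (p ∈ A ↔ E p)) ∧
  ∃ a, a ∈ dom (C_F S) ∧ ∀ π p, π ∈ base S a → p ∈ P → E p → E (app π p).

Lemma image_fixed π D : π ∈ grp S → D ⊆ P →
  (image π D = D ↔ ∀ p, p ∈ P → (p ∈ D ↔ app π p ∈ D)).
Proof.
  intros Hπ HD; split.
  - intros E p Hp; split; intros H.
    + rewrite <- E; apply mem_repl; eauto.
    + rewrite <- E in H; apply mem_repl in H as (q & Hq & E').
      now rewrite <- (app_invK Hπ Hp), E', app_invK by auto.
  - intros H; apply mem_ext; intros q; unfold image; rewrite mem_repl; split.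
    + intros (p & Hp & ->); apply (H p); auto.
    + intros Hq; assert (K := app_Kinv Hπ (HD q Hq)).
      exists (app (aut_inv S π) q); split; [|congruence].
      apply (H (app (aut_inv S π) q)); [auto using app_in, grp_inv|now rewrite K].
Qed.

Lemma symmetric_subset_intro D a : D ∈ classes M → D ⊆ P → a ∈ dom (C_F S) →
  (∀ π p, π ∈ base S a → p ∈ P → p ∈ D → app π p ∈ D) → symmetric_subset M S D.
Proof.
  intros DC DP Ha H; apply in_filter_intro.
  - apply definable_ext with (fun e => e 0 ∈ dom (C_G S) ∧
      ∀ p q, pair (e 0) (pair p q) ∈ C_G S → (p ∈ D ↔ q ∈ D)).
    + definability.
    + intros e He; split; intros [Hd K]; split; trivial.
      * intros p q Hp; apply C_G_app in Hp as (_ & Hp & ->).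
        apply image_fixed; auto using aut_in_grp.
      * apply image_fixed; auto using aut_in_grp.
        intros p Hp; apply K, C_G_app; auto.
  - split.
    + intros π Hπ; apply mem_sep in Hπ; tauto.
    + apply mem_sep; split; [apply grp_id|]; apply image_fixed; auto using grp_id.
      intros p Hp; now rewrite app_id.
    + intros π σ Hπ Hσ; apply mem_sep in Hπ as [Hπ E]; apply mem_sep in Hσ as [Hσ E'].
      rewrite image_fixed in E, E' by trivial.
      apply mem_sep; split; [now apply grp_comp|]; apply image_fixed; auto using grp_comp.
      intros p Hp; rewrite app_comp, E', E by auto using app_in; reflexivity.
    + intros π Hπ; apply mem_sep in Hπ as [Hπ E]; rewrite image_fixed in E by trivial.
      apply mem_sep; split; [now apply grp_inv|]; apply image_fixed; auto using grp_inv.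
      intros p Hp; rewrite (E (app (aut_inv S π) p)), app_Kinv by auto using app_in, grp_inv.
      reflexivity.
  - exists a; split; trivial; intros π Hπ; assert (Hπ' := base_grp Hπ).
    apply image_fixed; trivial; intros p Hp; split; [now apply H|].
    intros K; rewrite <- (app_invK Hπ' Hp); apply H; auto using app_in.
    now apply (subgroup_inv (sys_base_subgroup hS Ha)).
Qed.

(** Base groups are directed downwards, so finitely many names are fixed by
    one of them. *)
Lemma fixing_base n (x : nat → V) : (∀ i, hereditarily_symmetric M S (x i)) →
  ∃ a, a ∈ dom (C_F S) ∧ ∀ π, π ∈ base S a → ∀ i, i < n → act π (x i) = x i.
Proof.
  intros Hx; induction n as [|n (a & Ha & K)].
  - destruct (sys_base_top hS) as (a & Ha & _); exists a; split; trivial; lia.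
  - destruct (hs_base (Hx n)) as (b & Hb & L).
    destruct (sys_base_meet hS Ha Hb) as (c & Hc & Ca & Cb); exists c; split; trivial.
    intros π Hπ i Hi; destruct (Nat.eq_dec i n) as [-> |]; [auto|apply K; auto; lia].
Qed.

Lemma fixing_base2 x y : hereditarily_symmetric M S x → hereditarily_symmetric M S y →
  ∃ a, a ∈ dom (C_F S) ∧ ∀ π, π ∈ base S a → act π x = x ∧ act π y = y.
Proof.
  intros Hx Hy; destruct (@fixing_base 2 (scons x (fun _ => y))) as (a & Ha & K).
  { now intros [|]. }
  exists a; split; trivial; intros π Hπ; split; [apply (K π Hπ 0)|apply (K π Hπ 1)]; lia.
Qed.

Lemma mem_witness_symmetric x Y : x ∈ HS M S → class_name M S Y →
  symmetric_class (mem_witness x Y).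
Proof.
  intros Hx [YC HY]; split.
  - destruct (@comprehension (mem_witness x Y)) as (A & HA & E).
    { unfold definable1, mem_witness, f0_eq; definability. }
    exists A; split; trivial; intros p Hp; rewrite E; split; [tauto|].
    split; trivial; in_model.
  - destruct (fixing_base2 (HS_hs Hx) HY) as (a & Ha & K); exists a; split; trivial.
    intros π p Hπ Hp (z & r & Hz & Hr & H); assert (Hπ' := base_grp Hπ).
    destruct (K π Hπ) as [Kx KY].
    exists (act π z), (app π r); repeat split.
    + rewrite <- KY; now apply pair_act.
    + now apply leq_app.
    + rewrite <- Kx; apply f0_eq_act; trivial; exact (proj1 (hs_pair HY Hz)).
Qed.

(** Either p forces that x is included in y, or p forces a certain element of x
    to be present and not to belong to y.  Such conditions are dense: a
    condition not forcing the inclusion has an extension of the second kind by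
    the clause for inclusion. *)
Definition decides_sub (x y p : V) : Prop :=
  f_sub p x y ∨ ∃ z r, pair z r ∈ x ∧ leq S p r ∧ f_neg S (f_memC S F z y) p.

Lemma decides_sub_symmetric x y : x ∈ HS M S → y ∈ HS M S →
  symmetric_class (decides_sub x y).
Proof.
  intros Hx Hy; split.
  - destruct (@comprehension (decides_sub x y)) as (A & HA & E).
    { unfold definable1, decides_sub, f_sub, f_neg, f_memC, f0_eq; definability. }
    exists A; split; trivial; intros p Hp; rewrite E; split; [tauto|].
    split; trivial; in_model.
  - destruct (fixing_base2 (HS_hs Hx) (HS_hs Hy)) as (a & Ha & K); exists a; split; trivial.
    intros π p Hπ Hp H; assert (Hπ' := base_grp Hπ); destruct (K π Hπ) as [Kx Ky].
    destruct H as [H | (z & r & Hz & Hr & H)].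
    + left; rewrite <- Kx, <- Ky; now apply f_sub_act.
    + right; exists (act π z), (app π r); repeat split.
      * rewrite <- Kx; now apply pair_act.
      * now apply leq_app.
      * intros (q & Hq & L); apply H.
        assert (zH := proj1 (HS_pair Hx Hz)).
        exists (app (aut_inv S π) q); split.
        { rewrite <- (app_invK Hπ' Hp); apply leq_app; auto using grp_inv. }
        rewrite <- (act_invK Hπ' (HS_name zH)), <- (act_invK Hπ' (HS_name Hy)), Ky.
        apply f_memC_act; eauto using grp_inv, leq_left, HS_act, HS_hs.
Qed.

Lemma forces_symmetric φ x : (∀ i, x i ∈ HS M S) →
  symmetric_class (forces M S F φ x Γ).
Proof.
  intros Hx; split.
  - destruct (@comprehension_at _ x (forces_definable φ (fun i => 1 + i) 0)) as (A & HA & E).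
    { intros i; in_model. }
    exists A; split; trivial; intros p Hp; rewrite E; split; [tauto|].
    split; trivial; in_model.
  - destruct (forces_act φ) as [n H].
    destruct (fixing_base n (fun i => HS_hs (Hx i))) as (a & Ha & K).
    destruct (fixing_base n Γ_hs) as (b & Hb & L).
    destruct (sys_base_meet hS Ha Hb) as (c & Hc & Ca & Cb); exists c; split; trivial.
    intros π p Hπ Hp; apply H; auto; [exact (base_grp Hπ)|].
    intros i Hi; symmetry; auto.
Qed.

(** * Generic filters and truth *)

Variable G : V.
Hypothesis hG : is_generic M S G.

Lemma G_conds p : p ∈ G → p ∈ P.
Proof. apply (filter_sub (proj1 hG)). Qed.

Lemma G_up p q : p ∈ G → leq S p q → q ∈ G.
Proof. apply (filter_up (proj1 hG)). Qed.

Lemma G_dir p q : p ∈ G → q ∈ G → ∃ r, r ∈ G ∧ leq S r p ∧ leq S r q.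
Proof. apply (filter_dir (proj1 hG)). Qed.

(** Adding to E the conditions without extension in E makes it dense and keeps
    it symmetric.  A condition of G of the added kind has a common
    extension with p, and that one has an extension in E. *)
Lemma generic_meets_below E p : symmetric_class E → p ∈ G → dense_below S E p →
  ∃ q, q ∈ G ∧ E q.
Proof.
  intros [(A & HA & AE) (a & Ha & H)] Hp Hd.
  set (D := sep (fun q => q ∈ A ∨ ¬ ∃ r, leq S r q ∧ r ∈ A) P).
  destruct (proj2 hG D) as (q & Hq & qG).
  - apply sep_class; [apply conds_class|]; unfold definable1; definability.
  - intros q Hq; apply mem_sep in Hq; tauto.
  - apply symmetric_subset_intro with a; trivial.
    { apply sep_class; [apply conds_class|]; unfold definable1; definability. }
    { intros q Hq; apply mem_sep in Hq; tauto. }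
    intros π q Hπ Hq K; assert (Hπ' := base_grp Hπ).
    apply mem_sep in K as [_ K]; apply mem_sep; split; [now apply app_in|].
    destruct K as [K | K]; [left|right].
    + apply AE; auto using app_in; apply H; trivial; now apply AE.
    + intros (r & Hr & L); apply K; exists (app (aut_inv S π) r); split.
      { rewrite <- (app_invK Hπ' Hq); apply leq_app; auto using grp_inv. }
      assert (rP := leq_left Hr); apply AE; auto using app_in, grp_inv.
      apply H; trivial; [|now apply AE].
      now apply (subgroup_inv (sys_base_subgroup hS Ha)).
  - intros q Hq; destruct (classic (∃ r, leq S r q ∧ r ∈ A)) as [(r & Hr & K) | K].
    + exists r; split; trivial; apply mem_sep; split; [exact (leq_left Hr)|auto].
    + exists q; split; [apply mem_sep; auto|now apply leq_refl].
  - apply mem_sep in Hq as [qP [Hq | Hq]]; [exists q; split; trivial; now apply AE|].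
    destruct (G_dir Hp qG) as (r & rG & Hrp & Hrq).
    destruct (Hd r Hrp) as (s & Hs & K); destruct Hq; exists s.
    split; [exact (leq_trans Hs Hrq)|apply AE; trivial; exact (leq_left Hs)].
Qed.

Lemma valE (x u : V) : u ∈ val G x ↔ ∃ y p : V, pair y p ∈ x ∧ p ∈ G ∧ u = val G y.
Proof. apply mem_name_rec. Qed.

(** A condition in G below p forcing equality with z and below the condition r
    attached to z forces membership; conversely G meets the witnesses of
    membership, which are dense below p. *)
Lemma f_memC_truth_of x Y : x ∈ HS M S → class_name M S Y →
  (∀ z r, pair z r ∈ Y → (val G x = val G z ↔ ∃ p, p ∈ G ∧ f0_eq F p x z)) →
  (val G x ∈ val G Y ↔ ∃ p, p ∈ G ∧ f_memC S F x Y p).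
Proof.
  intros Hx HY H; split.
  - intros K; apply valE in K as (z & r & Hz & rG & E).
    apply (H z r Hz) in E as (p & pG & E); destruct (G_dir pG rG) as (q & qG & Hqp & Hqr).
    exists q; split; trivial; intros s Hs; exists s.
    assert (zH := proj1 (hs_pair (proj2 HY) Hz)).
    split; [apply leq_refl; exact (leq_left Hs)|].
    exists z, r; repeat split; trivial; [exact (leq_trans Hs Hqr)|].
    exact (f0_eq_mono Hx zH (leq_trans Hs Hqp) E).
  - intros (p & pG & K).
    destruct (generic_meets_below (mem_witness_symmetric Hx HY) pG K)
      as (q & qG & z & r & Hz & Hr & L).
    apply valE; exists z, r; repeat split; trivial; [exact (G_up qG Hr)|].
    apply (H z r Hz); eauto.
Qed.

(** G contains a condition deciding the inclusion.  If it decides against it, the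
    element it names has a value in the value of x, hence in that of y, which a
    common extension in G contradicts. *)
Lemma f_sub_truth_of x y : x ∈ HS M S → y ∈ HS M S →
  (∀ z r, pair z r ∈ x → (val G z ∈ val G y ↔ ∃ p, p ∈ G ∧ f_memC S F z y p)) →
  (val G x ⊆ val G y ↔ ∃ p, p ∈ G ∧ f_sub p x y).
Proof.
  intros Hx Hy H; split.
  - intros K; destruct (filter_nonempty (proj1 hG)) as [p0 p0G].
    destruct (generic_meets_below (decides_sub_symmetric Hx Hy) p0G)
      as (p & pG & [L | (z & r & Hz & Hr & L)]); [|eauto|exfalso].
    + intros p Hp; assert (pP := leq_left Hp).
      destruct (classic (f_sub p x y)) as [L | L].
      { exists p; split; [now apply leq_refl|now left]. }
      apply not_all_ex_not in L as [z L]; apply not_all_ex_not in L as [r L].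
      apply imply_to_and in L as [Hz L]; apply not_all_ex_not in L as [s L].
      apply imply_to_and in L as [Hs L]; apply imply_to_and in L as [Hr L].
      exists s; split; trivial; right; now exists z, r.
    + assert (zG : val G z ∈ val G y).
      { apply K, valE; exists z, r; repeat split; trivial; exact (G_up pG Hr). }
      apply (H z r Hz) in zG as (q & qG & E).
      destruct (G_dir pG qG) as (s & _ & Hsp & Hsq); apply L; exists s.
      split; trivial; exact (f_memC_mono Hsq E).
  - intros (p & pG & K) u Hu; apply valE in Hu as (z & r & Hz & rG & ->).
    destruct (G_dir pG rG) as (s & sG & Hsp & Hsr).
    apply (H z r Hz); exists s; split; trivial.
    intros q Hq; destruct (K z r Hz q) as (t & Ht & L); eauto using leq_trans.
    destruct (L t) as (v & Hv & w); [apply leq_refl; exact (leq_left Ht)|].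
    exists v; split; trivial; exact (leq_trans Hv Ht).
Qed.

Lemma HS_class_name x : x ∈ HS M S → class_name M S x.
Proof. intros Hx; split; [in_model|now apply HS_hs]. Qed.

(** The induction statement covers both orders, because inclusion of y in x
    asks for equality of elements of y with elements of x. *)
Lemma f0_eq_truth x y : x ∈ HS M S → y ∈ HS M S →
  (val G x = val G y ↔ ∃ p, p ∈ G ∧ f0_eq F p x y).
Proof.
  enough (H : ∀ x, x ∈ HS M S → ∀ y, y ∈ HS M S →
    (val G x = val G y ↔ ∃ p, p ∈ G ∧ f0_eq F p x y) ∧
    (val G y = val G x ↔ ∃ p, p ∈ G ∧ f0_eq F p y x)).
  { intros Hx Hy; now apply H. }
  clear x y; apply (HS_ind (Q := fun x => ∀ y, y ∈ HS M S → _)); intros x Hx IH y Hy.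
  assert (L : val G x ⊆ val G y ↔ ∃ p, p ∈ G ∧ f_sub p x y).
  { apply f_sub_truth_of; trivial; intros z r Hz.
    apply f_memC_truth_of; [exact (proj1 (HS_pair Hx Hz))|now apply HS_class_name|].
    intros w s Hw; apply (IH z r Hz); exact (proj1 (HS_pair Hy Hw)). }
  assert (R : val G y ⊆ val G x ↔ ∃ p, p ∈ G ∧ f_sub p y x).
  { apply f_sub_truth_of; trivial; intros w s Hw.
    assert (wH := proj1 (HS_pair Hy Hw)).
    apply f_memC_truth_of; [trivial|now apply HS_class_name|].
    intros z r Hz; apply (IH z r Hz); trivial. }
  assert (E : val G x = val G y ↔ ∃ p, p ∈ G ∧ f_sub p x y ∧ f_sub p y x).
  { split.
    - intros E; destruct L as [[p [pG Hp]] _]; [now rewrite E|].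
      destruct R as [[q [qG Hq]] _]; [now rewrite E|].
      destruct (G_dir pG qG) as (r & rG & Hrp & Hrq); exists r.
      eauto using f_sub_mono.
    - intros (p & pG & Hp & Hq); apply mem_ext; intros u; split; [apply L|apply R]; eauto. }
  split.
  - rewrite E; split; intros (p & pG & K); exists p; split; trivial;
      [apply f0_eq_sub|apply f0_eq_sub in K]; auto using G_conds.
  - transitivity (val G x = val G y); [split; congruence|].
    rewrite E; split; intros (p & pG & K); exists p; split; trivial;
      [apply f0_eq_sub|apply f0_eq_sub in K]; auto using G_conds; tauto.
Qed.

Lemma f_memC_truth x Y : x ∈ HS M S → class_name M S Y →
  (val G x ∈ val G Y ↔ ∃ p, p ∈ G ∧ f_memC S F x Y p).
Proof.
  intros Hx HY; apply f_memC_truth_of; trivial; intros z r Hz.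
  apply f0_eq_truth; trivial; exact (proj1 (hs_pair (proj2 HY) Hz)).
Qed.

Definition truth (φ : formula) : Prop := ∀ x, (∀ i, x i ∈ HS M S) →
  (sat (extension M S G) φ (fun i => val G (x i)) (fun k => val G (Γ k)) ↔
   ∃ p, p ∈ G ∧ forces M S F φ x Γ p).

Lemma truth_and φ ψ : truth φ → truth ψ → truth (And φ ψ).
Proof.
  intros H K x Hx; cbn [sat forces]; rewrite (H x Hx), (K x Hx); split.
  - intros [(p & pG & Hp) (q & qG & Hq)].
    destruct (G_dir pG qG) as (r & rG & Hrp & Hrq); exists r; split; trivial.
    exact (conj (forces_mono Hx Hrp Hp) (forces_mono Hx Hrq Hq)).
  - intros (p & pG & Hp & Hq); split; exists p; auto.
Qed.

Lemma symmetric_class_or A B : symmetric_class A → symmetric_class B →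
  symmetric_class (fun p => A p ∨ B p).
Proof.
  intros [(X & HX & EX) (a & Ha & HA)] [(Y & HY & EY) (b & Hb & HB)]; split.
  - destruct (@comprehension (fun p => p ∈ X ∨ p ∈ Y)) as (Z & HZ & EZ).
    { unfold definable1; definability. }
    exists Z; split; trivial; intros p Hp; rewrite EZ, <- EX, <- EY by trivial.
    split; [tauto|split; trivial; in_model].
  - destruct (sys_base_meet hS Ha Hb) as (c & Hc & Ca & Cb); exists c; split; trivial.
    intros π p Hπ Hp []; auto.
Qed.

(** The conditions forcing φ or its negation are dense, and G meets them. *)
Lemma truth_neg φ : truth φ → truth (Neg φ).
Proof.
  intros H x Hx; cbn [sat]; rewrite (H x Hx); split.
  - intros K; destruct (filter_nonempty (proj1 hG)) as [p0 p0G].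
    destruct (generic_meets_below (symmetric_class_or (forces_symmetric φ Hx)
      (forces_symmetric (Neg φ) Hx)) p0G) as (p & pG & [L | L]); [|destruct K; eauto|eauto].
    intros p Hp; assert (pP := leq_left Hp).
    destruct (classic (∃ q, leq S q p ∧ forces M S F φ x Γ q)) as [(q & Hq & L) | L].
    + exists q; auto.
    + exists p; split; [now apply leq_refl|now right].
  - intros (p & pG & K) (q & qG & L); destruct (G_dir pG qG) as (r & rG & Hrp & Hrq).
    apply K; exists r; split; trivial; exact (forces_mono Hx Hrq L).
Qed.

Lemma ex_witness_symmetric φ x : (∀ i, x i ∈ HS M S) →
  symmetric_class (fun p => ∃ z, z ∈ HS M S ∧ forces M S F φ (scons z x) Γ p).
Proof.
  intros Hx; split.
  - assert (D := forces_definable φ (scons 0 (fun i => 2 + i)) 1).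
    destruct (@comprehension_at (fun e => ∃ z, z ∈ HS M S ∧
      forces M S F φ (scons z (fun i => e (1 + i))) Γ (e 0)) x) as (A & HA & E).
    { definability; eapply definable_ext; [exact D|]; intros e He; cbv beta.
      now rewrite (scons_comp e 0 (fun i => 2 + i)). }
    { intros i; in_model. }
    exists A; split; trivial; intros p Hp; rewrite E; cbn; split; [tauto|].
    split; trivial; in_model.
  - destruct (forces_act φ) as [n H].
    destruct (fixing_base n (fun i => HS_hs (Hx i))) as (a & Ha & K).
    destruct (fixing_base n Γ_hs) as (b & Hb & L).
    destruct (sys_base_meet hS Ha Hb) as (c & Hc & Ca & Cb); exists c; split; trivial.
    intros π p Hπ Hp (z & Hz & Q); assert (Hπ' := base_grp Hπ).
    exists (act π z); split; [now apply HS_act|].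
    apply H with (scons z x); auto.
    + now intros [|i]; cbn.
    + intros [|i]; cbn; [now apply HS_act|trivial].
    + intros [|i] Hi; cbn; [trivial|symmetry; apply K; auto; lia].
Qed.

Lemma truth_ex φ : truth φ → truth (Ex φ).
Proof.
  intros H x Hx; cbn [sat].
  assert (Hc : ∀ z, z ∈ HS M S → ∀ i, scons z x i ∈ HS M S) by (now intros z Hz [|i]; cbn).
  split.
  - intros (u & Hu & K); apply mem_repl in Hu as (z & Hz & ->).
    rewrite <- (scons_comp (val G)) in K; apply (H _ (Hc z Hz)) in K as (p & pG & K).
    exists p; split; trivial; intros q Hq; exists q.
    split; [apply leq_refl; exact (leq_left Hq)|].
    exists z; split; trivial; exact (forces_mono (Hc z Hz) Hq K).
  - intros (p & pG & K).
    destruct (generic_meets_below (ex_witness_symmetric φ Hx) pG K) as (q & qG & z & Hz & L).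
    exists (val G z); split; [apply mem_repl; eauto|].
    rewrite <- (scons_comp (val G)); apply (H _ (Hc z Hz)); eauto.
Qed.

(** Values of class names consist of values of names in HS, so they are equal
    as soon as they have the same elements in the extension. *)
Lemma truth_EqC k l : truth (eqC_formula k l) → truth (EqC k l).
Proof.
  intros H x Hx; rewrite forces_EqC, <- (H x Hx); unfold eqC_formula; cbn [sat].
  cbn [scons]; split.
  - intros -> (u & _ & K); tauto.
  - intros K; apply mem_ext; intros u.
    assert (B : ∀ m, u ∈ val G (Γ m) → u ∈ sets (extension M S G)).
    { intros m Hu; apply valE in Hu as (y & p & Hy & _ & ->); apply mem_repl.
      exists y; split; trivial; exact (proj1 (hs_pair (Γ_hs m) Hy)). }
    destruct (classic (u ∈ sets (extension M S G))) as [Hu | Hu].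
    + apply NNPP; intros L; apply K; exists u; split; trivial; tauto.
    + split; intros L; destruct Hu; eauto.
Qed.

Lemma truth_all φ : truth φ.
Proof.
  elim φ using formula_EqC_ind; clear φ; auto using truth_and, truth_neg, truth_ex, truth_EqC.
  - intros i j x Hx; cbn [sat forces]; rewrite f_memC_truth by auto using HS_class_name.
    split; intros (p & pG & K); exists p; split; trivial;
      [apply f0_mem_memC|apply f0_mem_memC in K]; auto using G_conds.
  - intros i j x Hx; cbn [sat forces]; now apply f0_eq_truth.
  - intros i k x Hx; cbn [sat forces]; now apply f_memC_truth.
Qed.

End Forcing.

Theorem theorem23 (V : universe) (M : structure V) (S : system V)
    (hM : transitive_GB_model M) (hS : is_symmetric_system M S)
    (hadm : admits_forcing_relations M S)
    (F : V) (hF : is_atomic_forcing M S F)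
    (φ : formula) (Γ : nat → V) (hΓ : ∀ k, class_name M S (Γ k))
    (G : V) (hG : is_generic M S G)
    (x : nat → V) (hx : ∀ i, x i ∈ HS M S) :
  sat (extension M S G) φ (fun i => val G (x i)) (fun k => val G (Γ k)) ↔
  ∃ p, p ∈ G ∧ forces M S F φ x Γ p.
Proof. exact (truth_all hM hS hF hΓ hG φ hx). Qed.
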